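(* Let $t\in[0,1)$. Let $X$ belong to any one of the sets $\{d_p,\ell^p:1\le p<\infty\}\cup\{ces(p):1<p<\infty\}$, or $\{\ell(p+),ces(p+),d(p+):1\le p<\infty\}$, or $\{\ell(p-),ces(p-),d(p-):1<p\le\infty\}$. Then the dual operator $C_t'\in\mathcal{L}(X'_\beta)$ of $C_t\in\mathcal{L}(X)$ is power bounded and uniformly mean ergodic, but not supercyclic.
   Context: $\mathbb{N}_0=\{0,1,2,\dots\}$ and $\omega:=\mathbb{C}^{\mathbb{N}_0}$. For $t\in[0,1]$, $C_tx:=\left(\frac{t^nx_0+t^{n-1}x_1+\dots+x_n}{n+1}\right)_{n\in\mathbb{N}_0}$ for $x\in\omega$ (with $0^0:=1$); $C_t$ acts on a sequence space $X\subseteq\omega$ by restriction. Banach spaces: $\ell^q=\ell^q(\mathbb{N}_0)$ with its usual norm $\|\cdot\|_q$, $1\le q<\infty$; $ces(q):=\{x\in\omega: C_1|x|\in\ell^q\}$ with norm $\|x\|_{ces(q)}:=\|C_1|x|\,\|_q$, $1<q<\infty$, where $|x|=(|x_n|)_n$; $d_q:=\{x\in\ell^\infty:\hat x\in\ell^q\}$ with norm $\|x\|_{d_q}:=\|\hat x\|_q$, $1\le q<\infty$, where $\hat x:=(\sup_{k\ge n}|x_k|)_{n\in\mathbb{N}_0}$. Fréchet spaces: for $1\le p<\infty$ and a strictly decreasing sequence $(p_k)_{k\in\mathbb{N}}\subseteq(p,\infty)$ with $p_k\downarrow p$, $\ell(p+):=\bigcap_k\ell^{p_k}$, $ces(p+):=\bigcap_k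 ces(p_k)$, $d(p+):=\bigcap_k d_{p_k}$, with the topology generated by the corresponding norms. (LB)-spaces: for $1<p\le\infty$ and a strictly increasing sequence $(p_k)_{k\in\mathbb{N}}\subseteq(1,p)$ with $p_k\uparrow p$, $\ell(p-):=\mathrm{ind}_k\,\ell^{p_k}$, $ces(p-):=\mathrm{ind}_k\,ces(p_k)$, $d(p-):=\mathrm{ind}_k\,d_{p_k}$, i.e. the union of the respective Banach spaces with the finest locally convex topology making all their inclusions continuous. $X'_\beta$ is the topological dual $X'$ with the strong topology $\beta(X',X)$ (uniform convergence on bounded subsets of $X$); the dual operator $T'$ of $T\in\mathcal{L}(X)$ is $T'y:=y\circ T$. For a locally convex Hausdorff space $Z$, $\mathcal{L}(Z)$ is the space of continuous linear operators on $Z$ and $\mathcal{L}_b(Z)$ is $\mathcal{L}(Z)$ with the topology of uniform convergence on bounded sets. $T\in\mathcal{L}(Z)$ is power bounded if $\{T^n:n\in\mathbb{N}\}$ is equicontinuous; uniformly mean ergodic if $T_{[n]}:=\frac1n\sum_{m=1}^nT^m$ converges in $\mathcal{L}_b(Z)$ as $n\to\infty$; supercyclic if there is $z\in Z$ such that $\{\lambda T^nz:\lambda\in\mathbb{C},\ n\in\mathbb{N}_0\}$ is dense in $Z$. *)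

(* Defs.v *)
From HB Require Import structures.
From mathcomp Require Import all_boot all_order all_algebra complex.
From mathcomp Require Import all_classical all_reals all_analysis.

Set Implicit Arguments.
Unset Strict Implicit.
Unset Printing Implicit Defensive.

Import Order.TTheory GRing.Theory Num.Theory.
Import numFieldNormedType.Exports.

Local Open Scope classical_set_scope.
Local Open Scope ring_scope.

Lemma convex_setP (K : numDomainType) (E : lmodType K) (V : set E) :
  convex_set V <->
  forall (a b : K) (x y : E), 0 <= a -> 0 <= b -> a + b = 1 ->
    V x -> V y -> V (a *: x + b *: y).
Proof.
split=> [cV a b x y a0 b0 ab Vx Vy | cV x y l /[!inE] Vx Vy].
  have a1 : a <= 1 by rewrite -ab lerDl.
  have ai : Itv.spec (@Itv.num_sem K) (Itv.Real `[0, 1]%Z) a.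
    by rewrite /= /Itv.num_sem/= in_itv/= a0 a1 ger0_real.
  have -> : b = 1 - a by rewrite -ab addrC addKr.
  by have := cV x y (Itv.mk ai); rewrite !inE => /(_ Vx Vy).
by apply: cV => //; [rewrite subr_ge0|rewrite addrC subrK].
Qed.

(* A locally convex topology given by the filter of its zero neighbourhoods *)
HB.factory Record isLocallyConvex (K : numFieldType) E & GRing.Lmodule K E := {
  nbhs0 : set_system E ;
  nbhs0_filter : Filter nbhs0 ;
  nbhs0_absorbing : forall U x, nbhs0 U ->
    exists2 e : K, 0 < e & forall a, `|a| < e -> U (a *: x) ;
  nbhs0_balanced : forall U, nbhs0 U ->
    exists2 V, nbhs0 V & forall a x, `|a| <= 1 -> V x -> U (a *: x) ;
  nbhs0_scale : forall U (a : K), a != 0 -> nbhs0 U ->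
    nbhs0 [set x | U (a *: x)] ;
  nbhs0_convex : forall U, nbhs0 U ->
    exists V, [/\ nbhs0 V, V `<=` U & convex_set V]
}.

HB.builders Context (K : numFieldType) E & isLocallyConvex K E.

Local Notation N := (nbhs0 : set_system E).
Local Instance N_filter : Filter N := nbhs0_filter.

Lemma N0 U : N U -> U 0.
Proof.
move=> NU; have [e e0 /(_ 0)] := nbhs0_absorbing 0 NU.
by rewrite normr0 scaler0; exact.
Qed.

Lemma N_add U : N U -> exists2 V, N V & forall x y, V x -> V y -> U (x + y).
Proof.
move=> /nbhs0_convex[V [NV VU cV]]; exists [set x | V (2 *: x)].
  by apply: nbhs0_scale => //; rewrite pnatr_eq0.
move=> x y /= Vx Vy; apply: VU.
have -> : x + y = 2^-1 *: (2 *: x) + 2^-1 *: (2 *: y).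
  by rewrite !scalerA mulVf ?pnatr_eq0// !scale1r.
move/convex_setP: cV; apply=> //; rewrite ?invr_ge0//.
by rewrite -mulr2n -[LHS]mulr_natl mulfV ?pnatr_eq0.
Qed.

Definition nbhsE (x : E) : set_system E := [set U | N [set h | U (x + h)]].

HB.instance Definition _ := hasNbhs.Build E nbhsE.

Lemma nbhsE_filter (x : E) : ProperFilter (nbhs x).
Proof.
split; first by move=> /N0.
split; first exact: (@filterT _ N).
  by move=> P Q NP NQ; exact: (@filterI _ N).
by move=> P Q PQ; apply: (@filterS _ N) => h; exact: PQ.
Qed.

Lemma nbhsE_singleton (x : E) (A : set E) : nbhs x A -> A x.
Proof. by move=> /N0/=; rewrite addr0. Qed.

Lemma nbhsE_nbhs (x : E) (A : set E) : nbhs x A -> nbhs x (nbhs^~ A).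
Proof.
move=> /N_add[V NV VA]; apply: (@filterS _ N _ _ _ _ NV) => h Vh /=.
by apply: (@filterS _ N _ _ _ _ NV) => k Vk /=; rewrite -addrA; exact: VA.
Qed.

HB.instance Definition _ :=
  Nbhs_isNbhsTopological.Build E nbhsE_filter nbhsE_singleton nbhsE_nbhs.

Lemma near_shift (x : E) (V : set E) : N V -> nbhs x [set y | V (y - x)].
Proof.
move=> NV; apply: (@filterS _ N _ _ _ _ NV) => h Vh /=.
by rewrite addrC addKr.
Qed.

Lemma add_cont : continuous (fun x : E * E => x.1 + x.2).
Proof.
move=> [x y] U /= /N_add[V NV VU].
exists ([set z | V (z - x)], [set z | V (z - y)]) => /=.
  by split; exact: near_shift.
move=> [x' y'] /= [Vx Vy].
have := VU _ _ Vx Vy; rewrite /= => UU.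
by rewrite (_ : x' + y' = x + y + (x' - x + (y' - y)))// addrACA !subrKC.
Qed.

Lemma scale_cont : continuous (fun z : K^o * E => z.1 *: z.2).
Proof.
move=> [a x] U /= /N_add[V NV VU].
have [W NW WV] := N_add NV.
have [e e0 eW] := nbhs0_absorbing x NW.
have [W' NW' W'W] := nbhs0_balanced NW.
pose c := `|a| + e.
have c0 : 0 < c by rewrite ltr_wpDl.
exists ([set b : K^o | `|a - b| < e], [set y | W' (c *: (y - x))]) => /=.
  split; first by apply/nbhs_ballP; exists e.
  apply: (@near_shift x [set y | W' (c *: y)]).
  by apply: nbhs0_scale => //; rewrite gt_eqF.
move=> [b y] /= [ab W'y].
have -> : b *: y = a *: x + ((b - a) *: x + (b / c) *: (c *: (y - x))).
  rewrite scalerA divfK ?gt_eqF// scalerBl scalerBr addrA subrKC.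
  by rewrite addrC subrK.
have V1 : V ((b - a) *: x + (b / c) *: (c *: (y - x))).
  apply: WV; first by apply: eW; rewrite distrC.
  apply: W'W => //; rewrite normrM normfV (gtr0_norm c0) ler_pdivrMr// mul1r.
  rewrite -[b](subrK a) (le_trans (ler_normD _ _))// addrC lerD2l distrC.
  exact: ltW.
by rewrite -[X in U (_ + X)]addr0; apply: VU => //; exact: N0.
Qed.

Lemma interior_conv (V : set E) : convex_set V -> convex_set V°.
Proof.
move=> /convex_setP cV; apply/convex_setP => a b x y a0 b0 ab Vx Vy.
have : N ([set h | V (x + h)] `&` [set h | V (y + h)]).
  exact: (@filterI _ N).
apply: (@filterS _ N) => h [/= Vxh Vyh].
rewrite (_ : _ + h = a *: (x + h) + b *: (y + h)); first exact: cV.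
by rewrite !scalerDr addrACA -[in RHS](scalerDl h) ab scale1r.
Qed.

Lemma locally_conv : exists2 B : set_system E,
  (forall b, b \in B -> convex_set b) & basis B.
Proof.
exists [set U | open U /\ convex_set U]; first by move=> U /[!inE] -[].
split; first by move=> U [].
move=> x U /nbhs0_convex[V [NV VU cV]].
exists [set y | V° (y - x)]; last first.
  move=> y /= /interior_subset /VU /=.
  by rewrite addrC subrK.
split => /=; last first.
  rewrite subrr; apply: (@filterS _ N _ _ _ _ NV) => h.
  by rewrite /= add0r.
split.
  rewrite openE => y /= /nbhsE_nbhs; apply: (@filterS _ N) => h /=.
  by rewrite addrAC.
apply/convex_setP => a b y z a0 b0 ab /= Vy Vz.
rewrite (_ : _ - x = a *: (y - x) + b *: (z - x)).
  by move/convex_setP: (interior_conv cV); apply.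
by rewrite !scalerBr addrACA -opprD -(scalerDl x) ab scale1r.
Qed.

HB.instance Definition _ :=
  PreTopologicalLmod_isTvs.Build K E add_cont scale_cont locally_conv.

HB.instance Definition _ :=
  PreTopologicalNmodule_isTopologicalNmodule.Build E add_cont.
HB.instance Definition _ :=
  TopologicalNmodule_isTopologicalLmodule.Build K E scale_cont.
HB.instance Definition _ := Uniform_isTvs.Build K E locally_conv.

HB.end.

Section tvs_lemmas.
Context (K : numFieldType).
Implicit Types E F : tvsType K.

Lemma tvs_balanced E (U : set E) : nbhs 0 U ->
  exists2 V, nbhs 0 V & forall (a : K) x, `|a| <= 1 -> V x -> U (a *: x).
Proof.
move=> U0; have := @scale_continuous K E (0, 0) U.
rewrite /= scaler0 => /(_ U0)[[A W]/= [/nbhs_ballP[e /= e0 eA] W0] AWU].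
pose c : K := e / 2.
have c0 : c != 0 by rewrite gt_eqF// divr_gt0.
exists [set c *: x | x in W]; first exact: nbhs0Z.
move=> a _ a1 [x Wx <-]; rewrite scalerA.
apply: (AWU (a * c, x)); split => //=; apply: eA.
rewrite -ball_normE /= sub0r normrN normrM.
rewrite (le_lt_trans (ler_piMl _ a1))// gtr0_norm ?divr_gt0//.
by rewrite ltr_pdivrMr// ltr_pMr// ltr1n.
Qed.

Lemma tvs_scale E (U : set E) (a : K) : a != 0 -> nbhs 0 U ->
  nbhs 0 [set x | U (a *: x)].
Proof.
move=> a0 U0.
have /(@nbhs0Z _ _ _ a^-1) := U0; rewrite invr_eq0 => /(_ a0).
apply: filterS => _ [x Ux <-] /=.
by rewrite scalerA divff// scale1r.
Qed.

Lemma tvs_convex E (U : set E) : nbhs 0 U ->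
  exists V, [/\ nbhs 0 V, V `<=` U & convex_set V].
Proof.
move=> U0; have [B cB [oB bB]] := @locally_convex K E.
have [V [BV V0] VU] := bB 0 U U0.
exists V; split => //; first exact: open_nbhs_nbhs (conj (oB _ BV) V0).
by apply: cB; rewrite inE.
Qed.

Lemma linear_continuous0 E F (f : {linear E -> F}) :
  (forall U, nbhs 0 U -> nbhs 0 (f @^-1` U)) -> continuous f.
Proof.
move=> f0 x U Ux.
have /f0 : nbhs 0 [set y | U (f x + y)].
  have := @nbhsB _ F U (f x) (- f x) Ux; rewrite addNr.
  by apply: filterS => _ [y Uy <-] /=; rewrite addrA subrr add0r.
move=> /(@nbhsT _ E _ x); apply: filterS => _ [y Uy <-] /=.
by rewrite linearD.
Qed.

End tvs_lemmas.

Section bounded.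
Context (K : numFieldType) (E : tvsType K).

(* von Neumann boundedness; the library's [bounded_set] needs a norm *)
Definition tvs_bounded (B : set E) := forall U : set E, nbhs 0 U ->
  exists2 r : K, 0 < r & forall s, r <= `|s| -> B `<=` [set s *: x | x in U].

Lemma tvs_bounded0 : tvs_bounded set0.
Proof. by move=> U _; exists 1; [exact: ltr01|move=> s _ x]. Qed.

Lemma tvs_boundedU (A B : set E) :
  tvs_bounded A -> tvs_bounded B -> tvs_bounded (A `|` B).
Proof.
move=> bA bB U U0; have [r r0 rA] := bA U U0; have [s s0 sB] := bB U U0.
exists (r + s) => [|a rsa x [Ax|Bx]]; first exact: addr_gt0.
- by apply: rA => //; apply: le_trans rsa; rewrite lerDl ltW.
- by apply: sB => //; apply: le_trans rsa; rewrite lerDr ltW.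
Qed.

End bounded.

Section clin.
Context (K : numFieldType) (E F : tvsType K).

Definition clin_pred : {pred E -> F} :=
  [pred f | `[< linear f /\ continuous f >]].

(* the space L(E, F) of continuous linear maps; as a topological space it is
   L_b(E, F) *)
Record clin := CLin { clin_fun :> E -> F ; clinP : clin_fun \in clin_pred }.

HB.instance Definition _ := [isSub for clin_fun].
HB.instance Definition _ := gen_eqMixin clin.
HB.instance Definition _ := gen_choiceMixin clin.

Lemma clin_pred_closed : submod_closed clin_pred.
Proof.
have addc f g x : {for x, continuous f} -> {for x, continuous g} ->
    {for x, continuous (f + g : E -> F)}.
  move=> fx gx U /(@add_continuous F (f x, g x))[[A B] /= [fA gB] AB].
  apply: (@filterS2 _ (nbhs x) _ _ _ _ _ (fx _ fA) (gx _ gB)) => y Ay By.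
  exact: (AB (f y, g y)).
have zc (a : K) f x : {for x, continuous f} -> {for x, continuous (a *: f : E -> F)}.
  move=> fx U /(@scale_continuous K F (a, f x))[[A B] /= [fA gB] AB].
  apply: (@filterS _ (nbhs x) _ _ _ _ (fx _ gB)) => y By.
  by apply: (AB (a, f y)); split => //; exact: nbhs_singleton.
split.
  apply: asboolT; split; last by move=> x; exact: cvg_cst.
  by move=> a x y; rewrite /GRing.zero/= scaler0 addr0.
move=> a f g /asboolP[lf cf] /asboolP[lg cg].
apply: asboolT; split; last by move=> x; exact: addc (zc a f x (cf x)) (cg x).
move=> b x y; change (a *: f (b *: x + y) + g (b *: x + y) =
  b *: (a *: f x + g x) + (a *: f y + g y)); rewrite lf lg.
by rewrite !scalerDr !scalerA (mulrC a) addrACA.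
Qed.

HB.instance Definition _ :=
  GRing.isSubmodClosed.Build K (E -> F) clin_pred clin_pred_closed.
HB.instance Definition _ := [SubChoice_isSubLmodule of clin by <:].

Lemma clin_is_linear (f : clin) : linear f.
Proof. by case: f => f /= /asboolP[]. Qed.

Lemma clin_continuous (f : clin) : continuous f.
Proof. by case: f => f /= /asboolP[]. Qed.

HB.instance Definition _ (f : clin) :=
  GRing.isLinear.Build K E F _ f (clin_is_linear f).

(* uniform convergence on the bounded subsets of E *)
Definition clin_nbhs0 : set_system clin := [set W | exists B U,
  [/\ tvs_bounded B, nbhs 0 U & [set f : clin | f @` B `<=` U] `<=` W]].

Lemma clin_nbhs0_filter : Filter clin_nbhs0.
Proof.
split.
- by exists set0, setT; split=> //; [exact: tvs_bounded0|exact: filterT].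
- move=> P Q [A [U [bA U0 AU]]] [B [V [bB V0 BV]]].
  exists (A `|` B), (U `&` V); split; [exact: tvs_boundedU|exact: filterI|].
  move=> f /= fAB; split; [apply: AU|apply: BV] => _ [x xA <-].
  + by case: (fAB (f x)) => //; exists x => //; left.
  + by case: (fAB (f x)) => //; exists x => //; right.
- move=> P Q PQ [A [U [bA U0 AU]]]; exists A, U; split => //.
  exact: subset_trans PQ.
Qed.

Lemma clin_bounded (f : clin) (B : set E) (U : set F) :
  tvs_bounded B -> nbhs 0 U ->
  exists2 e : K, 0 < e & forall a, `|a| < e -> forall x, B x -> U (a *: f x).
Proof.
move=> bB U0.
have V0 : nbhs 0 (f @^-1` U) by apply: clin_continuous; rewrite linear0.
have [r r0 rB] := bB _ V0.
exists r^-1 => [|a ar x Bx]; first by rewrite invr_gt0.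
have [->|a0] := eqVneq a 0; first by rewrite scale0r; exact: nbhs_singleton.
have /rB : r <= `|a^-1|.
  by rewrite normfV -[r]invrK lef_pV2 ?posrE ?normr_gt0 ?invr_gt0// ltW.
move=> /(_ _ Bx)[y Uy <-].
by rewrite -linearZ /= scalerA divff// scale1r.
Qed.

Lemma clin_nbhs0_absorbing (W : set clin) (f : clin) : clin_nbhs0 W ->
  exists2 e : K, 0 < e & forall a, `|a| < e -> W (a *: f).
Proof.
move=> [B [U [bB U0 BU]]]; have [e e0 eU] := clin_bounded f bB U0.
by exists e => // a ae; apply: BU => _ [x Bx <-]; exact: eU.
Qed.

Lemma clin_nbhs0_balanced (W : set clin) : clin_nbhs0 W ->
  exists2 V, clin_nbhs0 V & forall (a : K) f, `|a| <= 1 -> V f -> W (a *: f).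
Proof.
move=> [B [U [bB U0 BU]]]; have [V V0 VU] := tvs_balanced U0.
exists [set f : clin | f @` B `<=` V]; first by exists B, V; split=> //.
move=> a f a1 fV; apply: BU => _ [x Bx <-] /=.
by apply: VU => //; apply: fV; exists x.
Qed.

Lemma clin_nbhs0_scale (W : set clin) (a : K) : a != 0 -> clin_nbhs0 W ->
  clin_nbhs0 [set f | W (a *: f)].
Proof.
move=> a0 [B [U [bB U0 BU]]]; exists B, [set x | U (a *: x)]; split => //.
  exact: tvs_scale.
by move=> f fB; apply: BU => _ [x Bx <-]; apply: fB; exists x.
Qed.

Lemma clin_nbhs0_convex (W : set clin) : clin_nbhs0 W ->
  exists V, [/\ clin_nbhs0 V, V `<=` W & convex_set V].
Proof.
move=> [B [U [bB U0 BU]]]; have [V [V0 VU /convex_setP cV]] := tvs_convex U0.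
exists [set f : clin | f @` B `<=` V]; split; first by exists B, V; split=> //.
  by move=> f fV; apply: BU; exact: subset_trans VU.
apply/convex_setP => a b f g a0 b0 ab fV gV _ [x Bx <-] /=.
by apply: cV => //; [apply: fV|apply: gV]; exists x.
Qed.

HB.instance Definition _ := isLocallyConvex.Build K clin clin_nbhs0_filter
  clin_nbhs0_absorbing clin_nbhs0_balanced clin_nbhs0_scale clin_nbhs0_convex.

End clin.

Section composition.
Context (K : numFieldType).
Implicit Types E F G : tvsType K.

Lemma clin_id_subproof E : (id : E -> E) \in @clin_pred K E E.
Proof. by apply: asboolT; split=> // x. Qed.

Definition clin_id E : clin E E := CLin (clin_id_subproof E).

Lemma clin_comp_subproof E F G (g : clin F G) (f : clin E F) :
  g \o f \in @clin_pred K E G.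
Proof.
apply: asboolT; split=> [a x y /=|x]; first by rewrite !linearP.
by apply: continuous_comp; exact: clin_continuous.
Qed.

Definition clin_comp E F G (g : clin F G) (f : clin E F) : clin E G :=
  CLin (clin_comp_subproof g f).

(* the strong dual: continuous functionals with uniform convergence on bounded
   sets; [K^o] is the scalar field seen as a topological vector space *)
Definition dual E := clin E K^o.
HB.instance Definition _ E := Tvs.on (dual E).

Definition dual_fun E (T : clin E E) (y : dual E) : dual E := clin_comp y T.

Lemma clin_bounded_image E F (f : clin E F) B :
  tvs_bounded B -> tvs_bounded (f @` B).
Proof.
move=> bB U U0.
have /bB[r r0 rB] : nbhs 0 (f @^-1` U).
  by apply: clin_continuous; rewrite linear0.
exists r => // s /rB sB _ [x /sB[y Uy <-] <-].
by exists (f y) => //; rewrite linearZ.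
Qed.

Lemma dual_fun_is_linear E (T : clin E E) : linear (dual_fun T).
Proof. by move=> a f g; apply: val_inj. Qed.

Lemma dual_op_subproof E (T : clin E E) :
  dual_fun T \in @clin_pred K (dual E) (dual E).
Proof.
have lT := dual_fun_is_linear T.
apply: asboolT; split=> //.
pose g : {linear dual E -> dual E} := HB.pack (dual_fun T)
  (GRing.isLinear.Build K (dual E) (dual E) _ (dual_fun T) lT).
apply: (@linear_continuous0 _ _ _ g) => W.
rewrite /nbhs/= => -[B [U [bB U0 BU]]].
exists (T @` B), U; split=> //; first exact: clin_bounded_image.
move=> y yU /=; rewrite add0r; have := BU (dual_fun T y); rewrite /= add0r; apply.
by move=> _ [x Bx <-]; apply: yU; exists (T x) => //; exists x.
Qed.

Definition dual_op E (T : clin E E) : clin (dual E) (dual E) :=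
  CLin (dual_op_subproof T).

End composition.

Section dynamics.
Context (K : numFieldType) (Z : tvsType K).
Implicit Types T : clin Z Z.

Definition clin_pow T n : clin Z Z := iter n (clin_comp T) (clin_id Z).

(* For linear maps equicontinuity amounts to equicontinuity at 0; the library's
   [equicontinuous] needs a pointed codomain *)
Definition clin_equicontinuous (A : set (clin Z Z)) :=
  forall U : set Z, nbhs 0 U ->
    exists2 V : set Z, nbhs 0 V & forall T, A T -> T @` V `<=` U.

Definition power_bounded T :=
  clin_equicontinuous [set clin_pow T n | n in [set n | (0 < n)%N]].

Definition ergodic_mean T n : clin Z Z :=
  n%:R^-1 *: \sum_(1 <= m < n.+1) clin_pow T m.

Definition uniformly_mean_ergodic T :=
  exists P : clin Z Z, ergodic_mean T n @[n --> \oo] --> P.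

Definition supercyclic T := exists z : Z,
  dense [set w | exists (a : K) n, w = a *: clin_pow T n z].

End dynamics.

Local Open Scope complex_scope.

Section seq_lcs.
Variable R : realType.
Local Notation C := R[i].
Local Notation omega := (nat -> R[i]).

(* A linear subspace of [omega] with a base of zero neighbourhoods; the latter
   are given as subsets of [omega] whose traces on the carrier matter *)
Record seq_lcs := SeqLcs {
  lcs_carrier : {pred omega} ;
  lcs_nbhs0 : set_system omega ;
  lcs_submod : submod_closed lcs_carrier ;
  lcs_filter : Filter lcs_nbhs0 ;
  lcs_absorbing : forall U x, x \in lcs_carrier -> lcs_nbhs0 U ->
    exists2 e : C, 0 < e & forall a : C, `|a| < e -> U (a *: x) ;
  lcs_balanced : forall U, lcs_nbhs0 U -> exists2 V, lcs_nbhs0 V &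
    forall (a : C) x, `|a| <= 1 -> V x -> U (a *: x) ;
  lcs_scale : forall U (a : C), a != 0 -> lcs_nbhs0 U ->
    lcs_nbhs0 [set x | U (a *: x)] ;
  lcs_convex : forall U, lcs_nbhs0 U ->
    exists V, [/\ lcs_nbhs0 V, V `<=` U & convex_set V]
}.

Section vector.
Variable X : seq_lcs.

Record lcs_vec := LcsVec {
  lcs_val :> omega ; lcs_valP : lcs_val \in lcs_carrier X }.

HB.instance Definition _ := [isSub for lcs_val].
HB.instance Definition _ := gen_eqMixin lcs_vec.
HB.instance Definition _ := gen_choiceMixin lcs_vec.
HB.instance Definition _ :=
  GRing.isSubmodClosed.Build C omega (lcs_carrier X) (lcs_submod X).
HB.instance Definition _ := [SubChoice_isSubLmodule of lcs_vec by <:].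

Definition vec_nbhs0 : set_system lcs_vec :=
  [set W | exists2 U, lcs_nbhs0 X U & lcs_val @^-1` U `<=` W].

Lemma vec_nbhs0_filter : Filter vec_nbhs0.
Proof.
have FX := lcs_filter X; split.
- by exists setT => //; exact: filterT.
- move=> P Q [U XU UP] [V XV VQ]; exists (U `&` V); first exact: filterI.
  by move=> x [Ux Vx]; split; [exact: UP|exact: VQ].
- by move=> P Q PQ [U XU UP]; exists U => //; exact: subset_trans PQ.
Qed.

Lemma vec_nbhs0_absorbing W (x : lcs_vec) : vec_nbhs0 W ->
  exists2 e : C, 0 < e & forall a, `|a| < e -> W (a *: x).
Proof.
move=> [U XU UW]; have [e e0 eU] := lcs_absorbing (lcs_valP x) XU.
by exists e => // a ae; apply: UW; exact: eU.
Qed.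

Lemma vec_nbhs0_balanced W : vec_nbhs0 W -> exists2 V, vec_nbhs0 V &
  forall (a : C) (x : lcs_vec), `|a| <= 1 -> V x -> W (a *: x).
Proof.
move=> [U XU UW]; have [V XV VU] := lcs_balanced XU.
exists (lcs_val @^-1` V); first by exists V.
by move=> a x a1 Vx; apply: UW; exact: VU.
Qed.

Lemma vec_nbhs0_scale W (a : C) : a != 0 -> vec_nbhs0 W ->
  vec_nbhs0 [set x | W (a *: x)].
Proof.
move=> a0 [U XU UW]; exists [set x | U (a *: x)]; first exact: lcs_scale.
by move=> x Ux; exact: UW.
Qed.

Lemma vec_nbhs0_convex W : vec_nbhs0 W ->
  exists V, [/\ vec_nbhs0 V, V `<=` W & convex_set V].
Proof.
move=> [U XU UW]; have [V [XV VU /convex_setP cV]] := lcs_convex XU.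
exists (lcs_val @^-1` V); split; first by exists V.
  by move=> x Vx; apply: UW; exact: VU.
by apply/convex_setP => a b x y a0 b0 ab Vx Vy; exact: cV.
Qed.

HB.instance Definition _ := isLocallyConvex.Build C lcs_vec vec_nbhs0_filter
  vec_nbhs0_absorbing vec_nbhs0_balanced vec_nbhs0_scale vec_nbhs0_convex.

End vector.
End seq_lcs.

Notation normc := ComplexField.Normc.normc.

Section norm_spaces.
Variable R : realType.
Local Notation C := R[i].
Local Notation omega := (nat -> R[i]).
Local Open Scope ereal_scope.

(* a norm with value [+oo] outside of its natural domain *)
Record exnorm := ExNorm {
  exn :> omega -> \bar R ;
  exn_ge0 : forall x, 0 <= exn x ;
  exnZ : forall a x, exn (a *: x)%R = (normc a)%:E * exn x ;
  exnD : forall x y, exn (x + y)%R <= exn x + exn y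
}.

Lemma exn0 (N : exnorm) : N 0%R = 0.
Proof. by rewrite -(scale0r 0%R) exnZ ComplexField.Normc.normc0 mul0e. Qed.

Definition exball (N : exnorm) (e : R) : set omega := [set x | N x < e%:E].

Lemma normc_ge0 (a : C) : (0 <= normc a)%R.
Proof. by case: a => a b; exact: sqrtr_ge0. Qed.

Lemma normcE (a : C) : `|a|%R = (normc a)%:C.
Proof. by []. Qed.

Lemma exnZ_lty (N : exnorm) a x : N x < +oo -> N (a *: x)%R < +oo.
Proof.
move=> Nx; rewrite exnZ lte_mul_pinfty// ?lee_fin ?normc_ge0//.
Qed.

Lemma exnD_lty (N : exnorm) x y : N x < +oo -> N y < +oo -> N (x + y)%R < +oo.
Proof.
by move=> Nx Ny; apply: le_lt_trans (exnD N x y) _; exact: lte_add_pinfty.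
Qed.

Lemma exball_convex (N : exnorm) e : convex_set (exball N e).
Proof.
apply/convex_setP => a b x y a0 b0 ab; rewrite /exball/= => Nx Ny.
apply: (le_lt_trans (exnD N _ _)); rewrite !exnZ.
have fN z : N z < e%:E -> (fine (N z))%:E = N z.
  by move=> Nz; rewrite fineK// ge0_fin_numE ?exn_ge0// (lt_trans Nz) ?ltry.
rewrite -(fN _ Nx) -(fN _ Ny) -!EFinM -EFinD lte_fin.
have nab : (normc a + normc b = 1)%R.
  have : ((normc a)%:C + (normc b)%:C = 1%:C :> C)%R.
    by rewrite -!normcE !ger0_norm.
  by rewrite -rmorphD => -[].
have -> : e = (normc a * e + normc b * e)%R by rewrite -mulrDl nab mul1r.
have Nx' : (fine (N x) < e)%R by rewrite -lte_fin fN.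
have Ny' : (fine (N y) < e)%R by rewrite -lte_fin fN.
have := normc_ge0 a; rewrite le_eqVlt => /predU1P[a00|a00].
  by move: nab; rewrite -a00 !mul0r !add0r => ->; rewrite !mul1r.
apply: ltr_leD; first by rewrite ltr_pM2l.
by rewrite ler_wpM2l ?normc_ge0// ltW.
Qed.

Lemma exball_balanced (N : exnorm) e a x :
  (`|a| <= 1)%R -> exball N e x -> exball N e (a *: x)%R.
Proof.
rewrite /exball/= normcE (_ : 1%R = 1%:C)// lecR => a1; apply: le_lt_trans.
by rewrite exnZ -[leRHS]mul1e; apply: lee_wpmul2r; rewrite ?exn_ge0 ?lee_fin.
Qed.

Lemma normc_gt0 (a : C) : a != 0%R -> (0 < normc a)%R.
Proof.
move=> a0; rewrite lt_neqAle normc_ge0 andbT eq_sym.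
by apply: contra a0 => /eqP/ComplexField.Normc.eq0_normc/eqP.
Qed.

Lemma exball_scale (N : exnorm) e (a : C) : a != 0%R -> (0 < e)%R ->
  exists2 d : R, (0 < d)%R & exball N d `<=` [set x | exball N e (a *: x)%R].
Proof.
move=> a0 e0; have na := normc_gt0 a0.
exists (e / normc a)%R; first exact: divr_gt0.
move=> x; rewrite /exball/= => Nx; rewrite exnZ muleC.
by rewrite -lte_pdivlMr// -EFinM.
Qed.

Lemma exball_absorbing (N : exnorm) e x : N x < +oo -> (0 < e)%R ->
  exists2 d : C, (0 < d)%R & forall a : C, (`|a| < d)%R -> exball N e (a *: x)%R.
Proof.
move=> Nx e0; pose r := (fine (N x) + 1)%R.
have fN : (fine (N x))%:E = N x.
  by rewrite fineK// ge0_fin_numE ?exn_ge0.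
have r0 : (0 < r)%R by rewrite ltr_wpDl// fine_ge0// exn_ge0.
exists (e / r)%:C%C; first by rewrite ltcR divr_gt0.
move=> a; rewrite normcE ltcR ltr_pdivlMr// => ar.
rewrite /exball/= exnZ -fN -EFinM lte_fin (le_lt_trans _ ar)//.
by rewrite ler_wpM2l ?normc_ge0// lerDl.
Qed.

Lemma exball_le (N : exnorm) (d e : R) : (d <= e)%R -> exball N d `<=` exball N e.
Proof. by move=> de x /lt_le_trans; apply; rewrite lee_fin. Qed.

(* intersection of the domains of the norms, with the topology they generate *)
Section projective.
Variables (I : eqType) (N : I -> exnorm).

Definition proj_carrier : {pred omega} :=
  [pred x | `[< forall i, N i x < +oo >]].

Definition proj_nbhs0 : set_system omega := [set U | exists (s : seq I) (e : R),
  (0 < e)%R /\ [set x | forall i, i \in s -> exball (N i) e x] `<=` U].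

Lemma proj_submod : submod_closed proj_carrier.
Proof.
split=> [|a x y /asboolP Nx /asboolP Ny]; apply: asboolT => i.
  by rewrite exn0.
by apply: exnD_lty => //; exact: exnZ_lty.
Qed.

Lemma proj_filter : Filter proj_nbhs0.
Proof.
split.
- by exists [::], 1%R.
- move=> P Q [s [d [d0 sP]]] [r [e [e0 rQ]]].
  exists (s ++ r), (Num.min d e); split; first by rewrite lt_min d0.
  move=> x /= srx; split; [apply: sP|apply: rQ] => i ii.
  + have := srx i; rewrite mem_cat ii => /(_ isT).
    by apply: exball_le; rewrite ge_min lexx.
  + have := srx i; rewrite mem_cat ii orbT => /(_ isT).
    by apply: exball_le; rewrite ge_min lexx orbT.
- move=> P Q PQ [s [d [d0 sP]]]; exists s, d; split => //.
  exact: subset_trans PQ.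
Qed.

Lemma proj_absorbing U x : x \in proj_carrier -> proj_nbhs0 U ->
  exists2 e : C, (0 < e)%R & forall a : C, (`|a| < e)%R -> U (a *: x)%R.
Proof.
move=> /asboolP Nx [s [d [d0 sU]]].
suff [e e0 es] : exists2 e : R, (0 < e)%R & forall a : C, (normc a < e)%R ->
    forall i, i \in s -> exball (N i) d (a *: x)%R.
  exists e%:C%C; first by rewrite ltcR.
  by move=> a; rewrite normcE ltcR => /es ea; exact: sU.
elim: s {sU} => [|i s [e e0 es]]; first by exists 1%R.
have [[f f'] /=] := exball_absorbing (Nx i) d0.
rewrite ltcE/= => /andP[/eqP f'0 f0] fi.
exists (Num.min e f) => [|a]; first by rewrite lt_min e0.
rewrite lt_min => /andP[ae af] j; rewrite inE => /predU1P[->|js].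
  by apply: fi; rewrite normcE ltcE/= f'0 eqxx.
exact: es.
Qed.

Lemma proj_balanced U : proj_nbhs0 U -> exists2 V, proj_nbhs0 V &
  forall (a : C) x, (`|a| <= 1)%R -> V x -> U (a *: x)%R.
Proof.
move=> [s [d [d0 sU]]].
exists [set x | forall i, i \in s -> exball (N i) d x]; first by exists s, d; split.
by move=> a x a1 sx; apply: sU => i si; apply: exball_balanced => //; exact: sx.
Qed.

Lemma proj_scale U (a : C) : a != 0%R -> proj_nbhs0 U ->
  proj_nbhs0 [set x | U (a *: x)%R].
Proof.
move=> a0 [s [d [d0 sU]]]; have na := normc_gt0 a0.
exists s, (d / normc a)%R; split; first exact: divr_gt0.
move=> x /= sx; apply: sU => i si; have := sx i si.
by rewrite /exball/= exnZ muleC -lte_pdivlMr// -EFinM.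
Qed.

Lemma proj_convex U : proj_nbhs0 U ->
  exists V, [/\ proj_nbhs0 V, V `<=` U & convex_set V].
Proof.
move=> [s [d [d0 sU]]].
exists [set x | forall i, i \in s -> exball (N i) d x]; split => //.
  by exists s, d; split.
apply/convex_setP => a b x y a0 b0 ab sx sy i si.
by move/convex_setP: (@exball_convex (N i) d); apply => //; [exact: sx|exact: sy].
Qed.

Definition proj_lcs : seq_lcs R := SeqLcs proj_submod proj_filter proj_absorbing
  proj_balanced proj_scale proj_convex.

End projective.

(* union of the domains of the norms; zero neighbourhoods are the sets that
   contain an absolutely convex set meeting each step in a zero neighbourhood *)
Section inductive.
Variable N : nat -> exnorm.
Hypothesis N_incr : forall k l x, (k <= l)%N -> N k x < +oo -> N l x < +oo.

Definition ind_carrier : {pred omega} :=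
  [pred x | `[< exists k, N k x < +oo >]].

Definition balanced_set (V : set omega) :=
  forall (a : C) x, (`|a| <= 1)%R -> V x -> V (a *: x)%R.

Definition ind_nbhs0 : set_system omega := [set U | exists V : set omega,
  [/\ V `<=` U, convex_set V, balanced_set V &
      forall k, exists2 e : R, (0 < e)%R & exball (N k) e `<=` V]].

Lemma ind_submod : submod_closed ind_carrier.
Proof.
split=> [|a x y /asboolP[k Nx] /asboolP[l Ny]]; apply: asboolT.
  by exists 0%N; rewrite exn0.
exists (maxn k l); apply: exnD_lty; last by apply: N_incr Ny; rewrite leq_maxr.
by apply: exnZ_lty; apply: N_incr Nx; rewrite leq_maxl.
Qed.

Lemma ind_filter : Filter ind_nbhs0.
Proof.
split.
- by exists setT; split=> // k; exists 1%R => //; exact: ltr01.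
- move=> P Q [U [UP /convex_setP cU bU NU]] [V [VQ /convex_setP cV bV NV]].
  exists (U `&` V); split.
  + by move=> x [Ux Vx]; split; [exact: UP|exact: VQ].
  + apply/convex_setP => a b x y a0 b0 ab [Ux Vx] [Uy Vy].
    by split; [exact: cU|exact: cV].
  + by move=> a x a1 [Ux Vx]; split; [exact: bU|exact: bV].
  + move=> k; have [d d0 dU] := NU k; have [e e0 eV] := NV k.
    exists (Num.min d e); first by rewrite lt_min d0.
    move=> x dex; split; [apply: dU|apply: eV]; move: dex; apply: exball_le.
    * by rewrite ge_min lexx.
    * by rewrite ge_min lexx orbT.
- move=> P Q PQ [U [UP cU bU NU]]; exists U; split => //.
  exact: subset_trans PQ.
Qed.

Lemma ind_absorbing U x : x \in ind_carrier -> ind_nbhs0 U ->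
  exists2 e : C, (0 < e)%R & forall a : C, (`|a| < e)%R -> U (a *: x)%R.
Proof.
move=> /asboolP[k Nx] [V [VU cV bV NV]]; have [e e0 eV] := NV k.
have [d d0 dx] := exball_absorbing Nx e0.
by exists d => // a /dx/eV/VU.
Qed.

Lemma ind_balanced U : ind_nbhs0 U -> exists2 V, ind_nbhs0 V &
  forall (a : C) x, (`|a| <= 1)%R -> V x -> U (a *: x)%R.
Proof.
move=> [V [VU cV bV NV]]; exists V; first by exists V; split.
by move=> a x a1 Vx; apply: VU; exact: bV.
Qed.

Lemma ind_scale U (a : C) : a != 0%R -> ind_nbhs0 U ->
  ind_nbhs0 [set x | U (a *: x)%R].
Proof.
move=> a0 [V [VU /convex_setP cV bV NV]]; exists [set x | V (a *: x)%R]; split.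
- by move=> x /VU.
- apply/convex_setP => b c x y b0 c0 bc Vx Vy /=.
  by rewrite scalerDr !scalerA ![(a * _)%R]mulrC -!scalerA; exact: cV.
- by move=> b x b1 Vx /=; rewrite scalerA mulrC -scalerA; exact: bV.
- move=> k; have [e e0 eV] := NV k.
  have [d d0 de] := exball_scale (N k) a0 e0.
  by exists d => // x /de/eV.
Qed.

Lemma ind_convex U : ind_nbhs0 U ->
  exists V, [/\ ind_nbhs0 V, V `<=` U & convex_set V].
Proof. by move=> [V [VU cV bV NV]]; exists V; split=> //; exists V; split. Qed.

Definition ind_lcs : seq_lcs R := SeqLcs ind_submod ind_filter ind_absorbing
  ind_balanced ind_scale ind_convex.

(* [ind_nbhs0] is the finest locally convex topology for which the inclusions
   of the steps are continuous *)
Lemma ind_lcs_continuous k (U : set omega) : lcs_nbhs0 ind_lcs U ->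
  exists2 e : R, (0 < e)%R & exball (N k) e `<=` U.
Proof.
move=> [V [VU _ _ NV]]; have [e e0 eV] := NV k.
by exists e => //; exact: subset_trans VU.
Qed.

Lemma ind_lcs_finest (X : seq_lcs R) :
  (forall k U, lcs_nbhs0 X U -> exists2 e : R, (0 < e)%R & exball (N k) e `<=` U) ->
  lcs_nbhs0 X `<=` lcs_nbhs0 ind_lcs.
Proof.
move=> NX U /lcs_convex[V [XV VU /convex_setP cV]].
exists [set x | forall a : C, (`|a| <= 1)%R -> V (a *: x)%R]; split.
- by move=> x /(_ 1%R); rewrite normr1 scale1r => /(_ (lexx _))/VU.
- apply/convex_setP => a b x y a0 b0 ab Vx Vy c c1.
  rewrite scalerDr !scalerA ![(c * _)%R]mulrC -!scalerA.
  by apply: cV => //; [exact: Vx|exact: Vy].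
- move=> a x a1 Vx b b1; rewrite scalerA; apply: Vx.
  by rewrite normrM mulr_ile1.
- move=> k; have [W XW WV] := lcs_balanced XV.
  have [e e0 eW] := NX k W XW; exists e => // x /eW Wx a a1.
  exact: WV.
Qed.

End inductive.
End norm_spaces.

Section lq.
Context {R : realType}.
Implicit Types (f g h : nat -> \bar R) (q : R).
Local Open Scope ereal_scope.

Definition lq q f : \bar R := 'N[counting]_(q%:E)[f].

Lemma lqE q f : (1 <= q)%R -> (forall n, 0 <= f n) ->
  lq q f = (\sum_(n <oo) f n `^ q) `^ q^-1.
Proof.
move=> q1 f0; rewrite /lq Lnorm_counting ?(lt_le_trans _ q1)//.
by congr (_ `^ _); apply: eq_eseriesr => n _; rewrite gee0_abs.
Qed.

Lemma lq_ge0 q f : 0 <= lq q f. Proof. exact: Lnorm_ge0. Qed.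

Lemma ge0_itv (x : \bar R) : 0 <= x -> x \in `[0, +oo].
Proof. by move=> x0; rewrite in_itv/= x0 leey. Qed.

Lemma lq_le q f g : (1 <= q)%R -> (forall n, 0 <= f n) ->
  (forall n, f n <= g n) -> lq q f <= lq q g.
Proof.
move=> q1 f0 fg; have g0 n : 0 <= g n by exact: le_trans (fg n).
have q0 : (0 <= q)%R by exact: le_trans q1.
rewrite !lqE//; apply: gt0_ler_poweR; rewrite ?invr_ge0//.
- by apply: ge0_itv; apply: nneseries_ge0 => n _ _; exact: poweR_ge0.
- by apply: ge0_itv; apply: nneseries_ge0 => n _ _; exact: poweR_ge0.
- apply: lee_nneseries => n _; first by rewrite poweR_ge0.
  by apply: gt0_ler_poweR => //; exact: ge0_itv.
Qed.

Lemma lq_scale q (r : R) f : (1 <= q)%R -> (0 <= r)%R -> (forall n, 0 <= f n) ->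
  lq q (fun n => r%:E * f n) = r%:E * lq q f.
Proof.
move=> q1 r0 f0; have q0 : (0 < q)%R by exact: lt_le_trans q1.
rewrite !lqE//; last by move=> n; rewrite mule_ge0.
under eq_eseriesr do rewrite poweRM ?lee_fin//.
rewrite poweR_EFin nneseriesZl; last by move=> n _; rewrite poweR_ge0.
rewrite poweRM ?lee_fin ?powR_ge0//; last first.
  by apply: nneseries_ge0 => n _ _; exact: poweR_ge0.
by rewrite poweR_EFin -powRrM mulfV ?gt_eqF// powRr1.
Qed.

Lemma lq_pinfty q f n : (1 <= q)%R -> (forall n, 0 <= f n) -> f n = +oo ->
  lq q f = +oo.
Proof.
move=> q1 f0 fn; have q0 : (0 < q)%R by exact: lt_le_trans q1.
rewrite lqE//; have -> : \sum_(k <oo) f k `^ q = +oo.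
  apply: (@nneseries_pinfty _ _ _ n) => // [k _|]; first exact: poweR_ge0.
  by rewrite fn poweRyr// gt_eqF.
by rewrite poweRyr// invr_eq0 gt_eqF.
Qed.

Lemma lq_add q f g h : (1 <= q)%R -> (forall n, 0 <= f n) ->
  (forall n, 0 <= g n) -> (forall n, 0 <= h n) ->
  (forall n, f n <= g n + h n) -> lq q f <= lq q g + lq q h.
Proof.
move=> q1 f0 g0 h0 fgh.
have [->|goo] := eqVneq (lq q g) +oo.
  by rewrite addye ?leey// gt_eqF// (lt_le_trans _ (lq_ge0 _ _)).
have [->|hoo] := eqVneq (lq q h) +oo.
  by rewrite addey ?leey// gt_eqF// (lt_le_trans _ (lq_ge0 _ _)).
have fin u (u0 : forall n, 0 <= u n) : lq q u != +oo ->
    EFin \o (fine \o u) = u.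
  move=> uoo; apply/funext => n /=; rewrite fineK// ge0_fin_numE// ltey.
  by apply: contra uoo => /eqP un; rewrite (lq_pinfty _ _ un).
rewrite -(fin _ g0 goo) -(fin _ h0 hoo).
have mR (u : nat -> R) : measurable_fun setT u by [].
have q1' : 1 <= q%:E by rewrite lee_fin.
apply: le_trans (eminkowski counting (mR (fine \o g)) (mR (fine \o h)) q1').
apply: lq_le => // n; rewrite (le_trans (fgh n))//=.
by rewrite EFinD -[X in X + _]/((EFin \o (fine \o g)) n)
   -[X in _ + X]/((EFin \o (fine \o h)) n) !fin.
Qed.

Lemma lq_incl q q' f : (1 <= q)%R -> (q <= q')%R -> (forall n, 0 <= f n) ->
  lq q f < +oo -> lq q' f < +oo.
Proof.
move=> q1 qq' f0; have q0 : (0 < q)%R by exact: lt_le_trans q1.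
have q'1 := le_trans q1 qq'; have q'0 := lt_le_trans q0 qq'.
rewrite !lqE//; set S := \sum_(_ <oo) _ => Soo.
have S0 : 0 <= S by apply: nneseries_ge0 => n _ _; exact: poweR_ge0.
have [M M0 fM] : exists2 M : R, (0 <= M)%R & forall n, f n <= M%:E.
  exists (fine (S `^ q^-1)); first by rewrite fine_ge0// poweR_ge0.
  move=> n; rewrite fineK ?ge0_fin_numE ?poweR_ge0//.
  have -> : f n = (f n `^ q) `^ q^-1.
    by rewrite -poweRrM mulfV ?gt_eqF// poweRe1.
  apply: gt0_ler_poweR; rewrite ?invr_ge0 ?(ltW q0)//.
  - by apply: ge0_itv; exact: poweR_ge0.
  - exact: ge0_itv.
  rewrite /S (@nneseriesD1 _ _ n xpredT)//; last first.
    by move=> k _; exact: poweR_ge0.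
  by rewrite leeDl// nneseries_ge0// => k _ _; exact: poweR_ge0.
apply: poweR_lty; apply: (@le_lt_trans _ _ ((M `^ (q' - q))%:E * S)).
  rewrite /S -nneseriesZl; last by move=> n _; exact: poweR_ge0.
  apply: lee_nneseries => [n _ _|n _]; first exact: poweR_ge0.
  rewrite -(subrK q q') poweRD; last first.
    by apply: add_neq0_poweRD_def; rewrite subrK gt_eqF.
  rewrite addrK; apply: lee_wpmul2r; first exact: poweR_ge0.
  rewrite -poweR_EFin; apply: gt0_ler_poweR => //.
  - by rewrite subr_ge0.
  - exact: ge0_itv.
  - by apply: ge0_itv; rewrite lee_fin.
rewrite lte_mul_pinfty ?lee_fin ?powR_ge0//.
by apply: lty_poweRy Soo; rewrite invr_eq0 gt_eqF.
Qed.

End lq.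

Section spaces.
Context {R : realType}.
Local Notation C := R[i].
Local Notation omega := (nat -> R[i]).

Definition cesaro_op (t : R) (x : omega) : omega := fun n =>
  (\sum_(i < n.+1) t%:C ^+ (n - i) * x i) / n.+1%:R.

Local Open Scope ereal_scope.

(* l^q, ces(q) and d_q are normed by the l^q norm of, respectively, |x|, C_1|x|
   and the least decreasing majorant of |x| *)
Inductive space_kind := Ell | Ces | Dee.

(* for [Dee] the suprema are infinite when x is unbounded, so that a finite norm
   implies that x is bounded *)
Definition transform (F : space_kind) (x : omega) (n : nat) : \bar R :=
  match F with
  | Ell => (normc (x n))%:E
  | Ces => (normc (cesaro_op 1 (fun k => `|x k|%R) n))%:E
  | Dee => ereal_sup [set (normc (x k))%:E | k in [set k | (n <= k)%N]]
  end.

Definition space_norm F (q : R) x := lq q (transform F x).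

Lemma transform_ge0 F x n : 0 <= transform F x n.
Proof.
case: F => /=; rewrite ?lee_fin ?normc_ge0//.
apply: (@le_trans _ _ (normc (x n))%:E); first by rewrite lee_fin normc_ge0.
by apply: ereal_sup_ubound; exists n => //=.
Qed.

Lemma normc_le (a b : C) : (0 <= a)%R -> (a <= b)%R -> (normc a <= normc b)%R.
Proof.
by move=> a0 ab; rewrite -lecR -!normcE !ger0_norm// (le_trans a0).
Qed.

Lemma normc_norm (a : C) : normc `|a|%R = normc a.
Proof. by apply: complexI; rewrite -!normcE normr_id. Qed.

Lemma cesaro_op_ge0 (x : omega) n :
  (forall k, 0 <= x k)%R -> (0 <= cesaro_op 1 x n)%R.
Proof.
move=> x0; rewrite /cesaro_op divr_ge0// sumr_ge0// => i _.
by rewrite rmorph1 expr1n mul1r.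
Qed.

Lemma transformZ F (a : C) x n :
  transform F (a *: x)%R n <= (normc a)%:E * transform F x n.
Proof.
case: F => /=.
- by rewrite -EFinM ComplexField.Normc.normcM.
- rewrite -EFinM lee_fin -(normc_norm a) -ComplexField.Normc.normcM.
  rewrite le_eqVlt; apply/orP; left; apply/eqP; congr normc.
  rewrite /cesaro_op mulrA mulr_sumr.
  congr (_ / _)%R; apply: eq_bigr => i _.
  by rewrite normrM mulrCA.
- apply: ge_ereal_sup => _ [k nk <-].
  rewrite ComplexField.Normc.normcM EFinM; apply: lee_wpmul2l.
    by rewrite lee_fin normc_ge0.
  by apply: ereal_sup_ubound; exists k.
Qed.

Lemma transformD F (x y : omega) n :
  transform F (x + y)%R n <= transform F x n + transform F y n.
Proof.
case: F => /=.
- by rewrite -EFinD lee_fin; exact: le_normcD.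
- rewrite -EFinD lee_fin; apply: le_trans (le_normcD _ _).
  apply: normc_le; first by apply: cesaro_op_ge0.
  rewrite /cesaro_op -mulrDl -big_split/= ler_pM2r ?invr_gt0 ?ltr0n//.
  by apply: ler_sum => i _; rewrite rmorph1 expr1n !mul1r ler_normD.
- apply: ge_ereal_sup => _ [k nk <-].
  apply: (@le_trans _ _ ((normc (x k))%:E + (normc (y k))%:E)).
    by rewrite -EFinD lee_fin; exact: le_normcD.
  by apply: leeD; apply: ereal_sup_ubound; exists k.
Qed.

Section exponent.
Variables (F : space_kind) (q : R).
Hypothesis q1 : (1 <= q)%R.

Let leZ (a : C) x : space_norm F q (a *: x)%R <= (normc a)%:E * space_norm F q x.
Proof.
rewrite -lq_scale ?normc_ge0//; last exact: transform_ge0.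
by apply: lq_le => // [n|n]; [exact: transform_ge0|exact: transformZ].
Qed.

Lemma space_normZ (a : C) x :
  space_norm F q (a *: x)%R = (normc a)%:E * space_norm F q x.
Proof.
apply/eqP; rewrite eq_le leZ/=.
have [->|a0] := eqVneq a 0%R.
  by rewrite ComplexField.Normc.normc0 mul0e; exact: lq_ge0.
rewrite muleC -lee_pdivlMr ?normc_gt0//.
rewrite -[in leLHS](scale1r x) -(mulVf a0) -scalerA muleC.
by rewrite (le_trans (leZ _ _))// ComplexField.Normc.normcV.
Qed.

Lemma space_normD (x y : omega) :
  space_norm F q (x + y)%R <= space_norm F q x + space_norm F q y.
Proof.
by apply: lq_add => // n; [exact: transform_ge0..|exact: transformD].
Qed.

Definition space_exnorm : exnorm R :=
  ExNorm (fun x => lq_ge0 q (transform F x)) space_normZ space_normD.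

Definition banach : seq_lcs R := proj_lcs (fun _ : unit => space_exnorm).

End exponent.

Section exponents.
Variables (F : space_kind) (p : nat -> R).
Hypothesis p1 : forall k, (1 <= p k)%R.

Definition frechet : seq_lcs R := proj_lcs (fun k => space_exnorm F (p1 k)).

Hypothesis p_incr : {homo p : k l / (k < l)%N >-> (k < l)%R}.

Lemma space_exnorm_incr k l x : (k <= l)%N ->
  space_exnorm F (p1 k) x < +oo -> space_exnorm F (p1 l) x < +oo.
Proof.
move=> kl; apply: lq_incl => //; last exact: transform_ge0.
by move: kl; rewrite leq_eqVlt => /predU1P[->//|/p_incr/ltW].
Qed.

Definition lb_space : seq_lcs R := ind_lcs space_exnorm_incr.

End exponents.

Inductive cesaro_space : seq_lcs R -> Prop :=
| Banach_case F (p : R) (p1 : (1 <= p)%R) :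
    (F = Ces -> (1 < p)%R) -> cesaro_space (banach F p1)
| Frechet_case F (p : R) (pk : nat -> R) (pk1 : forall k, (1 <= pk k)%R) :
    (1 <= p)%R -> {homo pk : k l / (k < l)%N >-> (l < k)%R} ->
    (forall k, p < pk k)%R -> pk @ \oo --> p -> cesaro_space (frechet F pk1)
| LB_case F (p : \bar R) (pk : nat -> R) (pk1 : forall k, (1 <= pk k)%R)
    (pk_incr : {homo pk : k l / (k < l)%N >-> (k < l)%R}) :
    1 < p -> (forall k, 1 < pk k)%R -> (forall k, (pk k)%:E < p) ->
    (pk k)%:E @[k --> \oo] --> p -> cesaro_space (lb_space F pk1 pk_incr).

End spaces.

(* Main.v *)
Require Import Defs.
From mathcomp Require Import all_boot all_order all_algebra complex.
From mathcomp Require Import all_classical all_reals all_analysis.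
From HB Require Import structures.
From mathcomp Require Import ring lra.

(* Let A be the convolution with (t^n), so that (C_t x)_n = (A x)_n / (n + 1).
   Since (A A a)_n <= (n + 1) (A a)_n for a >= 0, all powers satisfy
   |C_t^m x| <= A |x|, and A is bounded on each of the Banach spaces, with a
   constant depending on t only; hence the powers are equicontinuous on all the
   spaces X considered.  The fixed vectors of C_t are the multiples of (t^n);
   with P x = x_0 (t^n) and y = x - P x, the equation (1 - C_t) w = y has the
   explicit solution w = y + A (y_n / n), so that the means of the powers differ
   from P by (C_t w - C_t^(n+1) w) / n.  This is 1/n times an equicontinuous
   family, which gives uniform convergence of the means of the dual operator on
   bounded sets.  Finally, a dual operator cannot be supercyclic when the
   operator has eigenvectors for two eigenvalues of distinct modulus: here
   (t^n) for 1 and (n t^(n-1)) for 1/2. *)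

Set Implicit Arguments.
Unset Strict Implicit.
Unset Printing Implicit Defensive.

Import Order.TTheory GRing.Theory Num.Theory.
Import numFieldNormedType.Exports.

Local Open Scope classical_set_scope.
Local Open Scope ring_scope.

(** * Convolution with a geometric sequence *)

(** The recursive (Horner) form makes the bounds below one-step inductions on [n]; [geomE] recovers
    the convolution sum. *)
Fixpoint geom (A : pzRingType) (t : A) (x : nat -> A) (n : nat) : A :=
  if n is m.+1 then x m.+1 + t * geom t x m else x 0%N.

Section geom_ring.
Variables (A : comPzRingType) (t : A).
Implicit Types x y : nat -> A.

Lemma geomE x n : geom t x n = \sum_(i < n.+1) t ^+ (n - i) * x i.
Proof.
elim: n => [|n IHn]; first by rewrite big_ord_recl big_ord0 expr0 mul1r addr0.
rewrite big_ord_recr /= subnn expr0 mul1r IHn mulr_sumr addrC; congr (_ + _).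
by apply: eq_bigr => i _; rewrite mulrA -exprS subSn // -ltnS ltn_ord.
Qed.

Lemma geomD x y n : geom t (x + y) n = geom t x n + geom t y n.
Proof. by elim: n => //= n ->; rewrite fctE mulrDr addrACA. Qed.

Lemma geomZ a x n : geom t (fun k => a * x k) n = a * geom t x n.
Proof. by elim: n => //= n ->; rewrite mulrDr mulrCA. Qed.

(** Partial summation is convolution with the constant sequence 1, and convolutions commute. *)
Lemma sum_geom x n :
  \sum_(i < n.+1) geom t x i = geom t (fun k => \sum_(i < k.+1) x i) n.
Proof.
have rec : forall m, \sum_(i < m.+1) geom t x i =
    \sum_(i < m.+1) x i + t * \sum_(i < m) geom t x i.
  elim=> [|m IHm]; first by rewrite !big_ord_recl !big_ord0 mulr0 !addr0.
  rewrite big_ord_recr [X in X + _ = _]IHm [in RHS]big_ord_recr.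
  by rewrite [X in _ = _ + t * X]big_ord_recr /=; ring.
elim: n => [|n IHn]; first by rewrite rec big_ord0 mulr0 addr0.
by rewrite rec IHn.
Qed.

(* With [x k = y k / k], this says that [w := y + geom t x] satisfies
   [C_t w = geom t x], hence [w - C_t w = y]. *)
Lemma geom_resolvent x y n : y 0%N = 0 ->
  (forall k, k.+1%:R * x k.+1 = y k.+1) -> x 0%N = 0 ->
  geom t (y + geom t x) n = n.+1%:R * geom t x n.
Proof.
move=> y0 xy x0; elim: n => [|n IHn] /=; rewrite !fctE /=.
  by rewrite y0 x0 addr0 mulr0.
by rewrite IHn -xy -[n.+2%:R]natr1; ring.
Qed.

End geom_ring.

Section geom_real.
Variables (R : realFieldType) (t : R).
Hypothesis t0 : 0 <= t.
Implicit Types a b : nat -> R.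

Lemma geom_ge0 a n : (forall k, 0 <= a k) -> 0 <= geom t a n.
Proof. by move=> a0; elim: n => //= n IHn; rewrite addr_ge0 ?mulr_ge0. Qed.

Lemma le_geom a b n : (forall k, a k <= b k) -> geom t a n <= geom t b n.
Proof. by move=> ab; elim: n => //= n IHn; rewrite lerD ?ler_wpM2l. Qed.

Lemma geom_ge a n : (forall k, 0 <= a k) -> a n <= geom t a n.
Proof. by move=> a0; case: n => //= n; rewrite lerDl mulr_ge0 ?geom_ge0. Qed.

Lemma geom_ge_head a n : (forall k, 0 <= a k) -> a 0%N * t ^+ n <= geom t a n.
Proof.
move=> a0; elim: n => [|n IHn] /=; first by rewrite mulr1.
by rewrite exprS mulrCA -[leLHS]add0r lerD // ler_wpM2l.
Qed.

(** Convolving twice gives [a k] the weight (n - k + 1) t^(n-k), which is at most n + 1 times its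
    weight in a single convolution. *)
Lemma geom_geom_le a n : (forall k, 0 <= a k) ->
  geom t (geom t a) n <= n.+1%:R * geom t a n.
Proof.
move=> a0; elim: n => [|n IHn]; first by rewrite mul1r.
rewrite [geom t (geom t a) n.+1]/= -[n.+2%:R]natr1 mulrDl mul1r addrC lerD2r.
rewrite (le_trans (ler_wpM2l t0 IHn))// mulrCA ler_wpM2l//=.
by rewrite lerDr.
Qed.

(** With c = 1 / (1 - t), the bound c b is the fixed point of the recursion g -> b + t g, so it
    persists from index [n] on. *)
Lemma geom_tail_le a (b : R) n k : t < 1 -> (n <= k)%N -> 0 <= b ->
  (forall j, (n <= j)%N -> a j <= b) -> geom t a n <= b ->
  geom t a k <= (1 - t)^-1 * b.
Proof.
move=> t1 nk b0 ab gn.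
have s0 : 0 < 1 - t by rewrite subr_gt0.
have s1 : 1 <= (1 - t)^-1 by rewrite invf_ge1// gerBl.
elim: k nk => [|k IHk].
  by rewrite leqn0 => /eqP n0; move: gn; rewrite n0; nra.
rewrite leq_eqVlt => /predU1P[nk|nk]; first by move: gn; rewrite nk; nra.
have ak := ab _ (ltnW nk); have gk := ler_wpM2l t0 (IHk nk).
rewrite /=; apply: (le_trans (lerD ak gk)).
rewrite [leRHS](_ : _ = b + t * ((1 - t)^-1 * b))//.
by field; rewrite gt_eqF.
Qed.

End geom_real.

(** * Boundedness of the convolution on l^q *)

Section lq_geom.
Variables (R : realType) (t q : R).
Hypotheses (t0 : 0 <= t) (t1 : t < 1) (q1 : 1 <= q).
Implicit Types a : nat -> R.

Let c := (1 - t)^-1.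

Let s0 : 0 < 1 - t. Proof. by rewrite subr_gt0. Qed.

Let c0 : 0 < c. Proof. by rewrite invr_gt0. Qed.

(** Convexity of s^q at u + t v = (1 - t) (c u) + t v, multiplied by c = 1 / (1 - t). *)
Lemma powR_geom_step (u v : R) : 0 <= u -> 0 <= v ->
  c * (u + t * v) `^ q <= (c * u) `^ q + t * c * v `^ q.
Proof.
move=> u0 v0; have st : 1 - t <= 1 by rewrite gerBl.
have cu0 : 0 <= c * u by rewrite mulr_ge0// ltW.
have := convex_powR q1 (Itv01 (ltW s0) st) (x := c * u) (y := v).
rewrite !inE/= !in_itv/= !andbT => /(_ cu0 v0); rewrite convRE.
rewrite [X in X `^ _ <= _]convRE/= /unstable.onem.
rewrite mulrA divff ?gt_eqF// mul1r opprB addrCA subrr addr0.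
rewrite -(ler_pM2l c0) mulrDr mulrA mulVf ?gt_eqF// mul1r.
by rewrite (mulrA c) (mulrC c t).
Qed.

Lemma sum_powR_geom a n : (forall k, 0 <= a k) ->
  \sum_(i < n.+1) geom t a i `^ q <= \sum_(i < n.+1) (c * a i) `^ q.
Proof.
move=> a0.
(* The extra term makes the induction close: since c = 1 + t c, [powR_geom_step] uses up t c g_n^q
   and gives back both g_(n+1)^q and t c g_(n+1)^q, where g is the convolution. *)
suff : \sum_(i < n.+1) geom t a i `^ q + t * c * geom t a n `^ q <=
    \sum_(i < n.+1) (c * a i) `^ q.
  by apply: le_trans; rewrite lerDl !mulr_ge0 ?powR_ge0// ltW.
have ct : c = 1 + t * c by rewrite /c; field; rewrite gt_eqF.
elim: n => [|n IHn].
  have := powR_geom_step (a0 0%N) (lexx 0).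
  rewrite mulr0 addr0 powR0 ?mulr0 ?addr0 ?gt_eqF ?(lt_le_trans _ q1)//.
  by rewrite {1}ct mulrDl mul1r !big_ord_recl !big_ord0 !addr0.
have := powR_geom_step (a0 n.+1) (geom_ge0 t0 n a0).
rewrite {1}ct => step; rewrite big_ord_recr [leRHS]big_ord_recr /=.
by move: IHn step; rewrite /=; lra.
Qed.

Local Open Scope ereal_scope.

(** This is Young's inequality for the l^1 sequence (t^n), whose norm is c; it follows from the
    partial sums in [sum_powR_geom]. *)
Lemma lq_geom a : (forall k, 0 <= a k)%R ->
  lq q (fun n => (geom t a n)%:E) <= c%:E * lq q (fun n => (a n)%:E).
Proof.
move=> a0; have ca n : (0 <= c * a n)%R by rewrite mulr_ge0// ltW.
rewrite -lq_scale ?(ltW c0)//.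
have g0 n : (0 <= geom t a n)%R by rewrite geom_ge0.
rewrite !lqE//.
apply: gt0_ler_poweR; first by rewrite invr_ge0 (le_trans _ q1).
- by apply: ge0_itv; apply: nneseries_ge0 => n _ _; exact: poweR_ge0.
- by apply: ge0_itv; apply: nneseries_ge0 => n _ _; exact: poweR_ge0.
apply: lime_le; first by apply: is_cvg_nneseries => n _ _; exact: poweR_ge0.
near=> n.
apply: le_trans (nneseries_lim_ge n _); last by move=> *; exact: poweR_ge0.
rewrite !big_mkord; under eq_bigr do rewrite poweR_EFin.
under [leRHS]eq_bigr do rewrite -EFinM poweR_EFin.
rewrite !sumEFin lee_fin; have n0 : (0 < n)%N by near: n; exact: nbhs_infty_gt.
by rewrite -(prednK n0); exact: sum_powR_geom.
Unshelve. all: by end_near. Qed.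

End lq_geom.

(** * Passage to moduli and the norms of ces(q) and d_q *)

Section modulus.
Variable R : realType.
Local Notation C := R[i].
Local Notation omega := (nat -> C).
Implicit Types (x y : omega) (a b : nat -> R) (F : space_kind) (t q : R).

Definition modulus x n : R := normc (x n).

Lemma modulus_ge0 x n : 0 <= modulus x n. Proof. exact: normc_ge0. Qed.

Lemma normcC (r : R) : normc r%:C%C = `|r|.
Proof. by rewrite /= expr0n addr0 sqrtr_sqr. Qed.

Lemma normc_nat n : normc n%:R = n%:R :> R.
Proof. by rewrite -(rmorph_nat (real_complex R)) normcC normr_nat. Qed.

Lemma modulus_geom t x n : 0 <= t ->
  modulus (geom t%:C%C x) n <= geom t (modulus x) n.
Proof.
move=> t0; elim: n => //= n IHn; apply: (le_trans (le_normcD _ _)).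
by rewrite ComplexField.Normc.normcM normcC ger0_norm// lerD2l ler_wpM2l.
Qed.

Lemma cesaro_opE t x n : cesaro_op t x n = geom t%:C%C x n / n.+1%:R.
Proof. by rewrite /cesaro_op geomE. Qed.

Lemma modulus_cesaro t x n : 0 <= t ->
  modulus (cesaro_op t x) n <= geom t (modulus x) n / n.+1%:R.
Proof.
move=> t0; rewrite /modulus cesaro_opE ComplexField.Normc.normcM.
rewrite ComplexField.Normc.normcV normc_nat.
by rewrite ler_wpM2r ?invr_ge0//; exact: modulus_geom.
Qed.

Definition average a n : R := n.+1%:R^-1 * \sum_(i < n.+1) a i.

Lemma average_ge0 a n : (forall k, 0 <= a k) -> 0 <= average a n.
Proof. by move=> a0; rewrite mulr_ge0 ?invr_ge0// sumr_ge0. Qed.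

(** By [sum_geom] both sides are convolutions of the partial sums of [a], divided by n + 1
    throughout on the left, but termwise by k + 1 <= n + 1 on the right. *)
Lemma average_geom_le t a n : 0 <= t -> (forall k, 0 <= a k) ->
  average (geom t a) n <= geom t (average a) n.
Proof.
move=> t0 a0; rewrite /average sum_geom -geomZ; elim: n => [|n IHn] //=.
set S := fun n => \sum_(i < n.+1) a i.
have -> : geom t (fun k => n.+2%:R^-1 * S k) n =
    (n.+1%:R / n.+2%:R) * geom t (fun k => n.+1%:R^-1 * S k) n.
  by rewrite !geomZ mulrA (mulrAC n.+1%:R) divff ?pnatr_eq0// mul1r.
rewrite lerD2l ler_wpM2l// -[leRHS]mul1r; apply: le_trans (ler_wpM2l _ IHn).
- rewrite ler_wpM2r ?geom_ge0// => [k|].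
    by rewrite mulr_ge0 ?invr_ge0// sumr_ge0.
  by rewrite ler_pdivrMr// mul1r ler_nat.
- exact: ler01.
Qed.

Local Open Scope ereal_scope.

(** The norms see x only through |x|. Separating the modulus from [transform] gives a functional of
    real sequences that is monotone. *)
Definition real_transform F a n : \bar R :=
  match F with
  | Ell => (a n)%:E
  | Ces => (average a n)%:E
  | Dee => ereal_sup [set (a k)%:E | k in [set k | (n <= k)%N]]
  end.

Lemma transformE F x n : transform F x n = real_transform F (modulus x) n.
Proof.
case: F => //=; congr _%:E; rewrite -[RHS]ger0_norm; last first.
  by apply: average_ge0 => k; exact: modulus_ge0.
rewrite -normcC /average /cesaro_op mulrC rmorphM rmorph_sum fmorphV rmorph_nat.
congr normc; congr (_ * _)%R; apply: eq_bigr => i _.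
by rewrite rmorph1 expr1n mul1r.
Qed.

Lemma real_transform_ge0 F a n : (forall k, 0 <= a k)%R ->
  0 <= real_transform F a n.
Proof.
move=> a0; case: F => /=; rewrite ?lee_fin ?average_ge0//.
by apply: le_ereal_sup_tmp; exists (a n)%:E; [exists n => /=|rewrite lee_fin].
Qed.

Lemma le_real_transform F a b n : (forall k, a k <= b k)%R ->
  real_transform F a n <= real_transform F b n.
Proof.
move=> ab; case: F => /=; rewrite ?lee_fin//.
  by rewrite ler_wpM2l ?invr_ge0// ler_sum.
apply: ge_ereal_sup => _ [k nk <-]; apply: le_ereal_sup_tmp.
by exists (b k)%:E; [exists k|rewrite lee_fin].
Qed.

Section bound.
Variables (t q : R).
Hypotheses (t0 : (0 <= t)%R) (t1 : (t < 1)%R) (q1 : (1 <= q)%R).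

Let c := ((1 - t)^-1)%R.

Let c1 : (1 <= c)%R.
Proof. by rewrite invf_ge1 ?subr_gt0// gerBl. Qed.

Let c0 : (0 <= c)%R. Proof. exact: le_trans c1. Qed.

(** For [Ell] and [Ces] one factor c is enough, by [lq_geom] and [average_geom_le]. For [Dee] a
    second one arises from taking suprema over tails, in [geom_tail_le]; the exponent 2 covers all
    three kinds. *)
Lemma lq_geom_transform F a : (forall k, 0 <= a k)%R ->
  lq q (real_transform F (geom t a)) <= (c ^+ 2)%:E * lq q (real_transform F a).
Proof.
move=> a0; have ga0 n : (0 <= geom t a n)%R by exact: geom_ge0.
have T0 F' b n := @real_transform_ge0 F' b n.
have le2 z : 0 <= z -> c%:E * z <= (c ^+ 2)%:E * z.
  by move=> z0; rewrite lee_wpmul2r// lee_fin expr2 ler_peMr.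
case: F.
- exact: le_trans (lq_geom t0 t1 q1 a0) (le2 _ (lq_ge0 _ _)).
- have A0 k := average_ge0 k a0.
  apply: le_trans (le2 _ (lq_ge0 _ _)).
  apply: le_trans (lq_geom t0 t1 q1 A0); apply: lq_le => // n.
  + by rewrite lee_fin average_ge0.
  + by rewrite lee_fin average_geom_le.
- set h := real_transform Dee a.
  have h0 n : 0 <= h n by exact: (T0 Dee).
  (* An infinite right-hand side leaves nothing to prove; otherwise the decreasing majorant [h] is
     finite everywhere and [lq_geom] applies to it as a real sequence. *)
  have [->|hoo] := eqVneq (lq q h) +oo.
    by rewrite gt0_muley ?leey// lte_fin exprn_gt0// (lt_le_trans ltr01).
  have hE n : h n = (fine (h n))%:E.
    rewrite fineK// ge0_fin_numE// ltey; apply: contra hoo => /eqP hn.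
    by rewrite (lq_pinfty q1 h0 hn).
  have fh0 n : (0 <= fine (h n))%R by rewrite fine_ge0.
  have ah n k : (n <= k)%N -> (a k <= fine (h n))%R.
    by move=> nk; rewrite -lee_fin -hE; apply: ereal_sup_ubound; exists k.
  have -> : lq q h = lq q (EFin \o (fine \o h)).
    by congr (lq q _); apply/funext => n /=.
  rewrite expr2 EFinM -muleA.
  apply: le_trans (lee_wpmul2l _ (lq_geom t0 t1 q1 fh0)); rewrite ?lee_fin//.
  have gh0 n : (0 <= geom t (fine \o h) n)%R by exact: geom_ge0.
  rewrite -lq_scale//; apply: lq_le => // n; first exact: (T0 Dee).
  apply: ge_ereal_sup => _ [k nk <-]; rewrite -EFinM lee_fin.
  (* Here the bound b is the convolution of [h] at [n]: it dominates h_n, hence all a_j with j >= n,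
     and also the convolution of [a] at [n]. *)
  apply: (geom_tail_le t0 t1 nk (gh0 n)).
  + move=> j nj; apply: (le_trans (ah _ _ nj)).
    exact: (@geom_ge _ _ t0 (fine \o h)).
  + by apply: le_geom => // j; exact: ah.
Qed.

Lemma space_norm_geom F x y :
  (forall n, modulus y n <= geom t (modulus x) n)%R ->
  space_norm F q y <= (c ^+ 2)%:E * space_norm F q x.
Proof.
move=> yx; have m0 := modulus_ge0.
apply: (@le_trans _ _ (lq q (real_transform F (geom t (modulus x))))).
  apply: lq_le => // n; first exact: transform_ge0.
  by rewrite transformE; exact: le_real_transform.
have -> : space_norm F q x = lq q (real_transform F (modulus x)).
  by congr (lq q _); apply/funext => n; rewrite transformE.
exact: lq_geom_transform.
Qed.

End bound.
End modulus.

(** * Duality *)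

Section linear_maps.
Variables (K : numFieldType) (E : tvsType K).
Implicit Types T : clin E E.

Lemma clin_powSr T n x : clin_pow T n.+1 x = clin_pow T n (T x).
Proof. by rewrite /clin_pow; elim: n => //= n IHn; rewrite -IHn. Qed.

Lemma clin_sumE (F : tvsType K) (I : Type) (r : seq I) (f : I -> clin E F) x :
  (\sum_(i <- r) f i) x = \sum_(i <- r) f i x.
Proof. by elim/big_rec2: _ => // i a b _ <-. Qed.

Lemma clin_scaleE (F : tvsType K) (a : K) (f : clin E F) x :
  (a *: f) x = a *: f x.
Proof. by []. Qed.

Lemma clin_addE (F : tvsType K) (f g : clin E F) x : (f + g) x = f x + g x.
Proof. by []. Qed.

Lemma clin_compE (F G : tvsType K) (g : clin F G) (f : clin E F) x :
  clin_comp g f x = g (f x).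
Proof. by []. Qed.

Lemma clin_subE (F : tvsType K) (f g : clin E F) x : (f - g) x = f x - g x.
Proof. by []. Qed.

Lemma ergodic_meanE T n x :
  ergodic_mean T n x = n%:R^-1 *: \sum_(1 <= m < n.+1) clin_pow T m x.
Proof. by rewrite -clin_sumE. Qed.

Lemma eigen_pow T (a : K) x n : T x = a *: x -> clin_pow T n x = a ^+ n *: x.
Proof.
move=> Tx; elim: n => [|n IHn]; first by rewrite expr0 scale1r.
by rewrite clin_powSr Tx linearZ /= IHn scalerA -exprS.
Qed.

Lemma tvs_bounded1 (x : E) : tvs_bounded [set x].
Proof.
move=> V V0; have := @scale_continuous K E (0, x) V.
rewrite /= scale0r => /(_ V0)[[A W]/= [/nbhs_ballP[e /= e0 eA] Wx] AWV].
exists (2 / e); first by rewrite divr_gt0.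
move=> s es _ ->; have s0 : 0 < `|s| by apply: lt_le_trans es; rewrite divr_gt0.
exists (s^-1 *: x); last by rewrite scalerA divff ?scale1r// -normr_gt0.
apply: (AWV (s^-1, x)); split => /=; last exact: nbhs_singleton.
apply: eA; rewrite -ball_normE /= sub0r normrN normfV -[e]invrK.
rewrite ltf_pV2 ?posrE ?invr_gt0//; apply: lt_le_trans es.
by rewrite ltr_pMl ?invr_gt0// ltr1n.
Qed.

End linear_maps.

Section duality.
Variables (K : numFieldType) (E : tvsType K).
Implicit Types (T : clin E E) (y : dual E).

Lemma nbhs_clinP (F : tvsType K) (f : clin E F) (W : set (clin E F)) :
  nbhs f W <-> exists B (U : set F), [/\ tvs_bounded B, nbhs 0 U &
    forall g : clin E F, (forall x, B x -> U (g x)) -> W (f + g)].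
Proof.
split=> -[B [U [bB U0 BU]]]; exists B, U; split=> // g gB.
  by apply: BU => _ [x Bx <-]; exact: gB.
by apply: BU => x Bx; apply: gB; exists x.
Qed.

(** Boundedness of the union of the images makes its polars zero neighbourhoods of the strong dual;
    this is how equicontinuity passes to dual operators. *)
Lemma equicontinuous_bounded (A : set (clin E E)) B :
  clin_equicontinuous A -> tvs_bounded B ->
  tvs_bounded [set z | exists f x, [/\ A f, B x & z = f x]].
Proof.
move=> eA bB U /eA[V V0 VU]; have [r r0 rB] := bB V V0.
exists r => // s /rB sB _ [f [x [Af /sB[v Vv <-] ->]]].
by exists (f v); [apply: (VU f Af); exists v|rewrite linearZ].
Qed.

Lemma clin_pow_dual T n y x : clin_pow (dual_op T) n y x = y (clin_pow T n x).
Proof. by elim: n x => //= n IHn x; rewrite IHn -clin_powSr. Qed.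

(** If [y] maps the union [D] of all T^n B into [U], then every y o T^n maps [B] into [U], and [D]
    is bounded. *)
Lemma power_bounded_dual T : power_bounded T -> power_bounded (dual_op T).
Proof.
move=> pT W /nbhs_clinP[B [U [bB U0 BU]]].
have bD := equicontinuous_bounded pT bB.
pose D := [set z | exists f x,
  [/\ [set clin_pow T n | n in [set n | 0 < n]%N] f, B x & z = f x]].
exists [set y : dual E | forall x, D x -> U (y x)].
  by apply/nbhs_clinP; exists D, U; split=> // g gD; rewrite /= add0r.
move=> _ [n n0 <-] _ [y yD <-].
rewrite -[X in W X]add0r; apply: BU => x Bx; rewrite clin_pow_dual; apply: yD.
by exists (clin_pow T n), x; split=> //; exists n.
Qed.

Lemma ergodic_mean_dual T n y x :
  ergodic_mean (dual_op T) n y x = y (ergodic_mean T n x).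
Proof.
rewrite [ergodic_mean T n x]ergodic_meanE linearZ linear_sum.
rewrite [ergodic_mean (dual_op T) n y]ergodic_meanE clin_scaleE clin_sumE.
by congr (_ *: _); apply: eq_bigr => m _; rewrite clin_pow_dual.
Qed.

Lemma dual_eval_continuous (x : E) : continuous (fun y : dual E => (y x : K^o)).
Proof.
move=> y U Ux; apply/nbhs_clinP.
exists [set x], [set a : K^o | U (y x + a)]; split.
- exact: tvs_bounded1.
- have := nbhsB (- y x) Ux; rewrite addNr.
  by apply: filterS => _ [a Ua <-] /=; rewrite addrA subrr add0r.
- by move=> g gU; exact: (gU x).
Qed.

(* Evaluation at [v] and [w] maps an orbit of the dual operator into the set
   where [|y w|] is at most a constant multiple of [|y v|]. *)
Lemma not_supercyclic_dual T (v w : E) (a : K) (y z : dual E) :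
  T v = v -> T w = a *: w -> `|a| <= 1 -> y v != 0 -> z v = 0 -> z w != 0 ->
  ~ supercyclic (dual_op T).
Proof.
move=> Tv Tw a1 yv zv zw [u du].
have orb (h : dual E) : (exists (b : K) n, h = b *: clin_pow (dual_op T) n u) ->
    exists2 b : K, h v = b * u v & exists2 d : K, `|d| <= 1 & h w = b * d * u w.
  move=> [b [n ->]]; exists b.
    rewrite clin_scaleE clin_pow_dual (@eigen_pow _ _ T 1) ?scale1r//.
    by rewrite expr1n scale1r.
  exists (a ^+ n); first by rewrite normrX exprn_ile1.
  by rewrite clin_scaleE clin_pow_dual (eigen_pow n Tw) linearZ /= -mulrA.
have near_orb (h : dual E) W : nbhs h W ->
    exists2 g : dual E, W g & exists2 b : K, g v = b * u v &
      exists2 d : K, `|d| <= 1 & g w = b * d * u w.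
  move=> hW; have [||g [gW /orb ug]] := du W^°; last first.
  - by exists g => //; exact: interior_subset.
  - exact: open_interior.
  - by exists h.
have near_eval (h : dual E) x (e : K) : 0 < e ->
    nbhs h [set g : dual E | `|h x - g x| < e].
  move=> e0; have : nbhs (h x : K^o) [set b : K^o | `|h x - b| < e].
    by apply/nbhs_ballP; exists e.
  exact: (@dual_eval_continuous x h).
(* If [u v] is zero, the whole orbit vanishes at [v] and stays away from [y]. *)
have [uv|uv] := eqVneq (u v) 0.
  have yv0 : 0 < `|y v| by rewrite normr_gt0.
  have [g gy [b bv _]] := near_orb y _ (near_eval y v _ yv0).
  by move: gy => /=; rewrite bv uv mulr0 subr0 ltxx.
have zw0 : 0 < `|z w| by rewrite normr_gt0.
have uv0 : 0 < `|u v| by rewrite normr_gt0.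
(* The summand 1 only keeps [c] positive. The tolerances are chosen so that closeness to [z] at [w]
   forces |g w| > |z w| / 2, whereas closeness at [v] forces |b| c < |z w| / 2 and hence |g w| <= |z
   w| / 2. *)
pose c := `|u w| + 1; have c0 : 0 < c by rewrite ltr_wpDl.
have e0 : 0 < `|z w| / 2 by rewrite divr_gt0.
have d0 : 0 < `|z w| / 2 * `|u v| / c by rewrite divr_gt0 ?mulr_gt0.
have [g [gw gv] [b bv [d d1 dw]]] := near_orb z _
  (filterI (near_eval z w _ e0) (near_eval z v _ d0)).
have : `|z w| / 2 < `|g w|.
  rewrite -(ltrD2r (`|z w| / 2)) -splitr addrC.
  have := ler_normD (z w - g w) (g w); rewrite subrK => /le_lt_trans; apply.
  by rewrite ltrD2r.
apply/negP; rewrite -real_leNgt ?(normr_real, ger0_real (ltW e0))//.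
move: gv => /=; rewrite zv sub0r normrN bv ltr_pdivlMr// normrM => bc.
rewrite -(ler_pM2r uv0); apply: le_trans (ltW bc).
rewrite dw !normrM [leLHS](_ : _ = `|b| * `|u v| * (`|d| * `|u w|));
  last by ring.
rewrite ler_wpM2l ?mulr_ge0//.
by rewrite (le_trans (ler_piMl _ d1)) ?normr_ge0 ?lerDl.
Qed.

End duality.

(** * Uniform mean ergodicity of dual operators *)

Section mean_ergodic.
Variables (R : realType) (E : tvsType R[i]).

Lemma near_natr_ge (r : R[i]) : 0 < r -> \forall n \near \oo, r <= n%:R.
Proof.
case: r => r i; rewrite ltcE/= => /andP[/eqP i0 _].
near=> n; rewrite -(rmorph_nat (real_complex R)) lecE /= i0 eqxx/=.
by near: n; exact: nbhs_infty_ger.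
Unshelve. all: by end_near. Qed.

(** The error of the dual means at [y] is y o L_n divided by n. On a bounded set [B] the maps L_n
    take values in one bounded set [D], and a bounded set of functionals is absorbed by the polar of
    [D]. *)
Lemma uniformly_mean_ergodic_dual (T P : clin E E) (L : nat -> clin E E) :
  clin_equicontinuous (range L) ->
  (forall n x, (0 < n)%N -> ergodic_mean T n x - P x = n%:R^-1 *: L n x) ->
  uniformly_mean_ergodic (dual_op T).
Proof.
move=> eL TL; exists (dual_op P).
move=> W /nbhs_clinP[H [V [bH /nbhs_clinP[B [U [bB U0 BU]]] HW]]].
pose D := [set z | exists f x, [/\ range L f, B x & z = f x]].
have bD : tvs_bounded D := equicontinuous_bounded eL bB.
have D0 : nbhs (0 : dual E) [set y : dual E | forall x, D x -> U (y x)].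
  by apply/nbhs_clinP; exists D, U; split=> // g gD; rewrite /= add0r.
(* For n >= r each element of [H] is n g with g mapping [D] into [U]; the factor n cancels the 1/n
   of the error. *)
have [r r0 rH] := bH _ D0.
suff : \forall n \near \oo, W (ergodic_mean (dual_op T) n) by [].
near=> n.
have n0 : (0 < n)%N by near: n; exact: nbhs_infty_gt.
have rn : r <= `|n%:R| by rewrite normr_nat; near: n; exact: near_natr_ge.
rewrite -[ergodic_mean _ n](addrNK (dual_op P)) addrC.
apply: HW => _ /(rH _ rn)[g gD <-].
rewrite -[X in V X]add0r; apply: BU => x Bx.
have -> : (ergodic_mean (dual_op T) n - dual_op P) (n%:R *: g) x = g (L n x).
  rewrite (clin_subE (ergodic_mean (dual_op T) n)).
  rewrite (clin_subE (ergodic_mean (dual_op T) n (n%:R *: g))).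
  rewrite ergodic_mean_dual -linearB TL// linearZ /=.
  rewrite [X in _ *: X](_ : _ = n%:R *: g (L n x))// scalerA.
  by rewrite mulVf ?scale1r// pnatr_eq0 -lt0n.
by apply: gD; exists (L n), x; split.
Unshelve. all: by end_near. Qed.

End mean_ergodic.

(** * The sequence spaces *)

Section sequence_spaces.
Variable R : realType.
Local Notation C := R[i].
Local Notation omega := (nat -> R[i]).
Implicit Types (X : seq_lcs R) (F : space_kind) (q M : R) (x : omega).

Lemma nbhs_lcsP X (W : set (lcs_vec X)) : nbhs 0 W <->
  exists2 U : set omega, lcs_nbhs0 X U & forall x : lcs_vec X, U x -> W x.
Proof.
split=> -[U XU UW]; exists U => // x Ux.
  by have := UW x Ux; rewrite /= add0r.
by rewrite /= add0r; exact: UW.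
Qed.

(* [Banach_case] is the projective limit over a one-point index set *)
Lemma cesaro_space_elim (P : seq_lcs R -> Prop) :
  (forall (I : eqType) (i0 : I) F (p : I -> R) (p1 : forall i, 1 <= p i),
    (F = Ces -> forall i, 1 < p i) ->
    P (proj_lcs (fun i => space_exnorm F (p1 i)))) ->
  (forall F (p : nat -> R) (p1 : forall k, 1 <= p k)
      (p_incr : {homo p : k l / (k < l)%N >-> (k < l)}),
    (forall k, 1 < p k) -> P (lb_space F p1 p_incr)) ->
  forall X, cesaro_space X -> P X.
Proof.
move=> Pproj Pind X [F p p1 Fp | F p pk pk1 p1 _ pk_gt _ |
    F p pk pk1 pki _ pk_gt _ _].
- by apply: (Pproj unit tt F (fun=> p) (fun=> p1)) => /Fp.
- apply: (Pproj nat 0%N F pk pk1) => _ i.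

exact: le_lt_trans p1 (pk_gt i).
- exact: Pind.
Qed.

Local Open Scope ereal_scope.

(** The constant is uniform in the kind and the exponent, so that one estimate serves every step of
    a projective or inductive limit. *)
Definition norm_dominated M x y := forall F q, (1 <= q)%R ->
  space_norm F q y <= M%:E * space_norm F q x.

Lemma exball_dominated F q (q1 : (1 <= q)%R) M (e : R) x y : (0 < M)%R ->
  norm_dominated M x y -> exball (space_exnorm F q1) (e / M)%R x ->
  exball (space_exnorm F q1) e y.
Proof.
move=> M0 xy; rewrite /exball/= => xe; apply: le_lt_trans (xy F q q1) _.
by rewrite muleC -lte_pdivlMr// -EFinM.
Qed.

Lemma norm_dominated_lty F q M x y : (1 <= q)%R -> (0 < M)%R ->
  norm_dominated M x y -> space_norm F q x < +oo -> space_norm F q y < +oo.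
Proof.
move=> q1 M0 xy xoo; apply: le_lt_trans (xy F q q1) _.
by rewrite lte_mul_pinfty ?lee_fin// ltW.
Qed.

Lemma norm_dominated_carrier X M x y : cesaro_space X -> (0 < M)%R ->
  norm_dominated M x y -> x \in lcs_carrier X -> y \in lcs_carrier X.
Proof.
move=> cX M0 xy; elim/cesaro_space_elim: X / cX.
- move=> I _ F p p1 _ /asboolP Nx; apply: asboolT => i.
  exact: norm_dominated_lty xy (Nx i).
- move=> F p p1 pi _ /asboolP[k Nx]; apply: asboolT; exists k.
  exact: norm_dominated_lty xy Nx.
Qed.

Definition space_bounded X M (f : lcs_vec X -> lcs_vec X) :=
  forall x : lcs_vec X, norm_dominated M (lcs_val x) (lcs_val (f x)).

Lemma lcs_valD X (x y : lcs_vec X) :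
  lcs_val (x + y)%R = (lcs_val x + lcs_val y)%R.
Proof. by []. Qed.

Lemma lcs_val_inj X : injective (@lcs_val R X).
Proof. exact: val_inj. Qed.

Lemma lcs_valB X (x y : lcs_vec X) :
  lcs_val (x - y)%R = (lcs_val x - lcs_val y)%R.
Proof. by []. Qed.

Lemma lcs_valZ X (a : C) (x : lcs_vec X) :
  lcs_val (a *: x)%R = (a *: lcs_val x)%R.
Proof. by []. Qed.

(** In a projective limit the radii are divided by [M]. In an inductive limit, the vectors sent into
    [V] by all admissible maps at once form a convex balanced set containing the ball of radius e /
    M of each step. *)
Lemma space_bounded_equicontinuous X M (U : set (lcs_vec X)) :
  cesaro_space X -> (0 < M)%R -> nbhs 0%R U ->
  exists2 V : set (lcs_vec X), nbhs 0%R V &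
    forall f : {linear lcs_vec X -> lcs_vec X},
      space_bounded M f -> forall x : lcs_vec X, V x -> U (f x).
Proof.
move=> cX M0; elim/cesaro_space_elim: X / cX U.
- move=> I _ F p p1 _ U /nbhs_lcsP[W [s [e [e0 sW]]] WU].
  pose B := [set x | forall i, i \in s ->
    exball (space_exnorm F (p1 i)) (e / M)%R x].
  exists [set x | B (lcs_val x)].
    apply/nbhs_lcsP; exists B => //.
    by exists s, (e / M)%R; split; rewrite ?divr_gt0.
  move=> f fM x Bx; apply/WU/sW => i si.
  exact: exball_dominated (fM x) (Bx i si).
- move=> F p p1 pi _ U /nbhs_lcsP[W [V [VW /convex_setP cV bV NV]] WU].
  set X := lb_space F p1 pi in U WU *.
  (* Zero neighbourhoods are subsets of [omega] while the maps act on [lcs_vec X] only, hence the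
     preimage [u]. *)
  pose B (x : omega) := exists2 u : lcs_vec X, lcs_val u = x &
    forall f : {linear lcs_vec X -> lcs_vec X}, space_bounded M f -> V (f u).
  exists [set u | B (lcs_val u)].
    apply/nbhs_lcsP; exists B => //; exists B; split=> //.
    + apply/convex_setP => a b x y a0 b0 ab [u <- Vu] [v <- Vv].
      exists (a *: u + b *: v)%R => // f fM; rewrite linearP linearZ.
      by rewrite lcs_valD !lcs_valZ; apply: cV => //; [exact: Vu|exact: Vv].
    + move=> a x a1 [u <- Vu]; exists (a *: u)%R => // f fM.
      by rewrite linearZ lcs_valZ; apply: bV => //; exact: Vu.
    + move=> k; have [e e0 eV] := NV k; exists (e / M)%R; first exact: divr_gt0.
      move=> x xe; have Xx : x \in lcs_carrier X.
        by apply: asboolT; exists k; apply: lt_trans xe _; exact: ltry.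
      exists (LcsVec Xx) => // f fM; apply: eV.
      exact: exball_dominated (fM (LcsVec Xx)) xe.
  move=> f fM x [u /val_inj -> Vu]; apply/WU/VW; exact: Vu.
Qed.

(** Domination in all norms gives both the invariance of the carrier and continuity, whichever space
    [X] is. *)
Lemma lift_clin X M (L : omega -> omega) : cesaro_space X -> (0 < M)%R ->
  linear L -> (forall x, norm_dominated M x (L x)) ->
  exists2 f : clin (lcs_vec X) (lcs_vec X),
    space_bounded M f & forall x : lcs_vec X, lcs_val (f x) = L (lcs_val x).
Proof.
move=> cX M0 lL LM.
pose g (x : lcs_vec X) : lcs_vec X :=
  LcsVec (norm_dominated_carrier cX M0 (LM x) (lcs_valP x)).
have lg : linear g by move=> a x y; apply: val_inj; exact: lL.
pose g' : {linear lcs_vec X -> lcs_vec X} :=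
  HB.pack g (GRing.isLinear.Build _ _ _ _ g lg).
have gM : space_bounded M g' by move=> x; exact: LM.
have cg : continuous g'.
  apply: linear_continuous0 => U /(space_bounded_equicontinuous cX M0)[V V0 VU].
  by apply: filterS V0; exact: VU.
have gP : g \in @clin_pred _ (lcs_vec X) (lcs_vec X) by apply: asboolT; split.
by exists (CLin gP).
Qed.

Lemma space_bounded_clin_equicontinuous X M : cesaro_space X -> (0 < M)%R ->
  clin_equicontinuous [set f : clin (lcs_vec X) (lcs_vec X) | space_bounded M f].
Proof.
move=> cX M0 U /(space_bounded_equicontinuous cX M0)[V V0 VU].
by exists V => // f fM _ [x Vx <-]; exact: VU.
Qed.

End sequence_spaces.

(** * Unit vectors and coordinate functionals *)

Section coordinates.
Variable R : realType.
Local Notation C := R[i].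
Local Notation omega := (nat -> R[i]).
Implicit Types (X : seq_lcs R) (F : space_kind) (q : R) (x : omega).

(* [(1 - u)^-d >= 1 + d u] with [u = (n + 2)^-1] makes the terms of the series
   telescope *)
Lemma sum_inv_powR (d : R) n : 0 < d ->
  d * \sum_(i < n.+1) expR (- (1 + d) * ln i.+1%:R) <=
  d + 1 - expR (- d * ln n.+1%:R).
Proof.
move=> d0; elim: n => [|n IHn].
  by rewrite big_ord_recl big_ord0 addr0 ln1 !mulr0 expR0 mulr1 addrK.
rewrite big_ord_recr mulrDr /=; apply: (le_trans (lerD IHn (lexx _))).
set m : R := n.+2%:R; have m0 : 0 < m by rewrite ltr0n.
have mE : n.+1%:R = m * (1 - m^-1).
  by rewrite mulrBr mulr1 divff ?gt_eqF// /m -[n.+2%:R]natr1 addrK.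
have u0 : 0 < 1 - m^-1 by rewrite -(pmulr_rgt0 _ m0) -mE ltr0n.
have lnu : ln (1 - m^-1) <= - m^-1.
  rewrite -[leRHS]expRK ler_ln ?posrE ?expR_gt0//.
  exact: expR_ge1Dx.
pose E := expR (- d * ln m); have E0 : 0 < E by exact: expR_gt0.
have -> : expR (- (1 + d) * ln m) = m^-1 * E.
  by rewrite opprD mulrDl mulN1r expRD expRN lnK ?posrE.
have -> : expR (- d * ln n.+1%:R) = E * expR (- d * ln (1 - m^-1)).
  by rewrite mE lnM ?posrE// mulrDr expRD.
have : 1 + d * m^-1 <= expR (- d * ln (1 - m^-1)).
  apply: le_trans (expR_ge1Dx _).
  by rewrite lerD2l mulNr -mulrN ler_pM2l// lerNr.
rewrite -(ler_pM2l E0) -/E mulrDr mulr1 [m^-1 * E]mulrC (mulrCA E) => step.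
rewrite -addrA lerD2l; clearbody E.
by move: step; move: (E * expR _) (d * (E * _)) => x y; lra.
Qed.

Lemma lq_inv_expn q (r : nat) : 1 <= q -> 1 < r%:R * q ->
  (lq q (fun n => (n.+1%:R^-1 ^+ r)%:E) < +oo)%E.
Proof.
move=> q1 rq; have q0 : 0 < q by exact: lt_le_trans q1.
have f0 n : (0 <= (n.+1%:R^-1 ^+ r : R)%:E)%E.
  by rewrite lee_fin exprn_ge0// invr_ge0.
rewrite lqE//; apply: poweR_lty.
(* The series has exponent r q = 1 + d, and [sum_inv_powR] bounds its partial sums by (d + 1) /
   d. *)
pose d := r%:R * q - 1; have d0 : 0 < d by rewrite subr_gt0.
apply: (@le_lt_trans _ _ ((d + 1) / d)%:E); last exact: ltry.
apply: lime_le.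
  by apply: is_cvg_nneseries => n _ _; exact: poweR_ge0.
near=> n; have n0 : (0 < n)%N by near: n; exact: nbhs_infty_gt.
rewrite big_mkord; under eq_bigr do rewrite poweR_EFin.
rewrite sumEFin lee_fin ler_pdivlMr// mulrC -(prednK n0).
apply: (@le_trans _ _ (d + 1 - expR (- d * ln n.-1.+1%:R))); last first.
  by rewrite gerBl expR_ge0.
apply: le_trans (sum_inv_powR _ d0); rewrite ler_wpM2l ?(ltW d0)//.
apply: ler_sum => i _; rewrite /powR expf_eq0 invr_eq0 pnatr_eq0 andbF.
rewrite lnXn ?invr_gt0 ?ltr0n// lnV ?posrE ?ltr0n// /d.
rewrite [1 + _]addrC subrK le_eqVlt; apply/orP; left; apply/eqP; congr expR.
by rewrite -mulr_natl; ring.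
Unshelve. all: by end_near. Qed.

Definition unit_seq n : omega := fun k => (k == n)%:R.

Lemma unit_seq_norm F q n : 1 <= q -> (F = Ces -> 1 < q) ->
  (space_norm F q (unit_seq n) < +oo)%E.
Proof.
move=> q1 Fq; pose r := if F is Ces then 1%N else 2%N.
have rq : 1 < r%:R * q.
  have q0 : 0 < q by exact: lt_le_trans q1.
  by rewrite /r; case: F Fq {r} => [_|/(_ erefl)|_]; lra.
have mu k : modulus (unit_seq n) k = (k == n)%:R.
  by rewrite /modulus normc_nat.
have h0 k : (0 <= (k.+1%:R^-1 ^+ r : R)%:E)%E.
  by rewrite lee_fin exprn_ge0// invr_ge0.
apply: (@le_lt_trans _ _ ((n.+1%:R ^+ 2 : R)%:E *
    lq q (fun k => (k.+1%:R^-1 ^+ r)%:E))%E); last first.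
  by rewrite lte_mul_pinfty ?lee_fin ?exprn_ge0//; exact: lq_inv_expn.
rewrite -lq_scale ?exprn_ge0//; apply: lq_le => // k; first exact: transform_ge0.
rewrite transformE -EFinM.
have le2 j m : (m <= j)%N ->
    modulus (unit_seq n) j <= n.+1%:R ^+ 2 * m.+1%:R^-1 ^+ 2.
  move=> mj; rewrite mu -exprMn; have [jn|] := eqVneq j n; last first.
    by rewrite exprn_ge0// mulr_ge0.
  by rewrite exprn_ege1// ler_pdivlMr// mul1r ler_nat ltnS -jn.
rewrite /r; case: F {Fq h0 rq r} => /=; rewrite ?lee_fin.
- exact: le2.
- rewrite /average expr1 mulrC ler_wpM2r// (@le_trans _ _ 1)//; last first.
    by rewrite exprn_ege1// ler1n.
  under eq_bigr do rewrite mu.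
  have [nk|kn] := ltnP n k.+1.
    rewrite (bigD1 (Ordinal nk))//= eqxx big1 ?addr0// => i.
    by rewrite -val_eqE /= => /negbTE ->.
  rewrite big1// => i _; case: eqP => // ik.
  by have := ltn_ord i; rewrite ik ltnNge kn.
- by apply: ge_ereal_sup => _ [j kj <-]; rewrite lee_fin; exact: le2.
Qed.

Lemma unit_seq_carrier X n : cesaro_space X -> unit_seq n \in lcs_carrier X.
Proof.
elim/cesaro_space_elim => [I _ F p p1 Fp|F p p1 pi Fp]; apply: asboolT.
  by move=> i; apply: unit_seq_norm => // /Fp.
by exists 0%N; apply: unit_seq_norm.
Qed.

Lemma le_lq (f : nat -> \bar R) q n : 1 <= q -> (forall k, 0 <= f k)%E ->
  (f n <= lq q f)%E.
Proof.
move=> q1 f0; have q0 : 0 < q by exact: lt_le_trans q1.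
have S0 : (0 <= \sum_(k <oo) f k `^ q)%E.
  by apply: nneseries_ge0 => k _ _; exact: poweR_ge0.
rewrite lqE// -[leLHS](poweRe1 (f0 n)) -(mulfV (negbT (gt_eqF q0))) poweRrM.
apply: gt0_ler_poweR; rewrite ?invr_ge0 ?(ltW q0)//.
- by apply: ge0_itv; exact: poweR_ge0.
- exact: ge0_itv.
rewrite (@nneseriesD1 _ _ n xpredT)//; last by move=> k _; exact: poweR_ge0.
by rewrite leeDl// nneseries_ge0// => k _ _; exact: poweR_ge0.
Qed.

(** The factor n + 1 is due to [Ces], where the n-th average controls only |x_n| / (n + 1). *)
Lemma coordinate_le F q x n : 1 <= q ->
  ((modulus x n)%:E <= n.+1%:R%:E * space_norm F q x)%E.
Proof.
move=> q1; have T0 k := transform_ge0 F x k.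
apply: le_trans (lee_wpmul2l _ (le_lq n q1 T0)); rewrite ?lee_fin//.
rewrite transformE; case: F {T0} => /=.
- by rewrite -EFinM lee_fin ler_peMl ?modulus_ge0 ?ler1n.
- rewrite -EFinM lee_fin /average mulrA divff ?mul1r ?pnatr_eq0//.
  by rewrite big_ord_recr /= lerDr sumr_ge0// => i _; exact: modulus_ge0.
- apply: (@le_trans _ _ (1 * (ereal_sup
      [set (modulus x k)%:E | k in [set k | (n <= k)%N]]))%E).
    by rewrite mul1e; apply: ereal_sup_ubound; exists n => /=.
  rewrite lee_wpmul2r ?lee_fin ?ler1n//; apply: le_ereal_sup_tmp.
  by exists (modulus x n)%:E; [exists n => /=|rewrite lee_fin modulus_ge0].
Qed.

(** Only a seminorm, but this packaging makes [exball_convex] and [exball_balanced] available for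
    the slabs |x_n| < e. *)
Definition coordinate_exnorm (n : nat) : exnorm R.
Proof.
apply: (@ExNorm _ (fun x => (modulus x n)%:E)) => [x|a x|x y].
- by rewrite lee_fin modulus_ge0.
- by rewrite -EFinM -ComplexField.Normc.normcM.
- by rewrite -EFinD lee_fin; exact: le_normcD.
Defined.

Lemma coordinate_functional X (n : nat) : cesaro_space X ->
  exists y : dual (lcs_vec X), forall x : lcs_vec X, y x = lcs_val x n.
Proof.
move=> cX; pose g (x : lcs_vec X) : C^o := lcs_val x n.
have lg : linear g by [].
pose g' : {linear lcs_vec X -> C^o} :=
  HB.pack g (GRing.isLinear.Build _ _ _ _ g lg).
suff cg : continuous g'.
  have gP : g \in @clin_pred _ (lcs_vec X) C^o by apply: asboolT; split.
  by exists (CLin gP).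
apply: linear_continuous0 => U /nbhs_ballP[[e i]] /=.
rewrite ltcE/= => /andP[/eqP -> e0] eU; apply/nbhs_lcsP.
pose W := exball (coordinate_exnorm n) e.
exists W => [|x Wx]; last first.
  apply: eU; rewrite -ball_normE /= sub0r normrN.
  suff : ((normc (lcs_val x n))%:C < e%:C)%C by [].
  by rewrite ltcR -lte_fin.
have ballW F q (q1 : 1 <= q) : exball (space_exnorm F q1) (e / n.+1%:R) `<=` W.
  move=> x; rewrite /exball/= => xe.
  rewrite /W /exball /=; apply: le_lt_trans (coordinate_le F x n q1) _.
  by rewrite muleC -lte_pdivlMr// -EFinM.
have en : 0 < e / n.+1%:R by rewrite divr_gt0.
elim/cesaro_space_elim: X / cX {g lg g'} => [I i0 F p p1 _|F p p1 pi _].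
  exists [:: i0], (e / n.+1%:R); split=> // x /(_ i0).
  by rewrite inE eqxx => /(_ isT); exact: ballW.
exists W; split=> //.
- exact: exball_convex.
- by move=> a x; exact: exball_balanced.
- by move=> k; exists (e / n.+1%:R) => //; exact: ballW.
Qed.

End coordinates.

(** * The Cesaro operator *)

Section cesaro.
Variables (R : realType) (t : R) (X : seq_lcs R).
Hypotheses (t0 : 0 <= t) (t1 : t < 1) (cX : cesaro_space X).
Local Notation C := R[i].
Local Notation omega := (nat -> R[i]).
Local Notation V := (lcs_vec X).
Implicit Types (x y : omega) (f g : clin V V) (M : R).

Let K : R := (1 - t)^-1 ^+ 2.

Let K0 : 0 < K. Proof. by rewrite exprn_gt0// invr_gt0 subr_gt0. Qed.

Lemma modulus_le_dominated x y :
  (forall n, modulus y n <= geom t (modulus x) n) -> norm_dominated K x y.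
Proof. by move=> xy F q q1; exact: space_norm_geom. Qed.

Lemma space_bounded_id : space_bounded 1 (@clin_id _ V).
Proof. by move=> x F q q1; rewrite mul1e. Qed.

Lemma space_boundedD M N f g : 0 <= M -> 0 <= N ->
  space_bounded M f -> space_bounded N g -> space_bounded (M + N) (f + g).
Proof.
move=> M0 N0 fM gN x F q q1; rewrite clin_addE lcs_valD.
apply: (le_trans (space_normD F q1 _ _)).
by rewrite EFinD ge0_muleDl ?lee_fin//; apply: leeD; [exact: fM|exact: gN].
Qed.

Lemma space_boundedN M f : space_bounded M f -> space_bounded M (- f).
Proof.
move=> fM x F q q1; apply: le_trans (fM x F q q1).
rewrite -scaleN1r clin_scaleE lcs_valZ.
rewrite space_normZ// (_ : normc (-1) = 1) ?mul1e//.
by rewrite -(rmorphN1 (real_complex R)) normcC normrN1.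
Qed.

Lemma space_bounded_comp M N f g : 0 <= M ->
  space_bounded M f -> space_bounded N g ->
  space_bounded (M * N) (clin_comp f g).
Proof.
move=> M0 fM gN x F q q1; apply: (le_trans (fM (g x) F q q1)).
by rewrite EFinM -muleA lee_wpmul2l ?lee_fin//; exact: gN.
Qed.

Lemma geom_linear : linear (geom t%:C%C : omega -> omega).
Proof.
by move=> a x y; apply/funext => n; rewrite geomD (geomZ _ a x).
Qed.

Definition cesaro_limit x : omega := fun n => x 0%N * t%:C%C ^+ n.

(** The term at n = 0 is zero by the convention for division by 0, as [geom_resolvent] requires. *)
Definition weighted_geom x : omega := geom t%:C%C (fun n => x n / n%:R).

Lemma cesaro_op_linear : linear (cesaro_op t).
Proof.
move=> a x y; apply/funext => n.
by rewrite cesaro_opE geom_linear !fctE mulrDl !cesaro_opE -mulrA.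
Qed.

Lemma cesaro_limit_linear : linear cesaro_limit.
Proof.
by move=> a x y; apply/funext => n; rewrite /cesaro_limit !fctE mulrDl -mulrA.
Qed.

Lemma weighted_geom_linear : linear weighted_geom.
Proof.
move=> a x y; rewrite /weighted_geom -geom_linear; congr (geom _ _).
by apply/funext => n; rewrite !fctE mulrDl -mulrA.
Qed.

(** Each further application of C_t adds a convolution and divides by n + 1; by [geom_geom_le] the
    division pays for the convolution, so the bound does not grow with [m]. *)
Lemma modulus_iter_cesaro m x n :
  modulus (iter m (cesaro_op t) x) n <= geom t (modulus x) n.
Proof.
have m0 := modulus_ge0 x.
elim: m n => [|m IHm] n; first exact: (geom_ge t0).
rewrite iterS; apply: (le_trans (modulus_cesaro _ _ t0)).
rewrite ler_pdivrMr// mulrC; apply: le_trans (geom_geom_le t0 n m0).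
by apply: le_geom.
Qed.

Lemma cesaro_op_dominated x : norm_dominated K x (cesaro_op t x).
Proof. by apply: modulus_le_dominated => n; exact: (modulus_iter_cesaro 1). Qed.

Lemma cesaro_limit_dominated x : norm_dominated K x (cesaro_limit x).
Proof.
apply: modulus_le_dominated => n; apply: le_trans (geom_ge_head t0 n _).
  rewrite /modulus /cesaro_limit ComplexField.Normc.normcM -rmorphXn normcC.
  by rewrite ger0_norm// exprn_ge0.
exact: modulus_ge0.
Qed.

Lemma weighted_geom_dominated x : norm_dominated K x (weighted_geom x).
Proof.
apply: modulus_le_dominated => n; apply: (le_trans (modulus_geom _ _ t0)).
apply: le_geom => // -[|k].
  by rewrite /modulus invr0 mulr0 ComplexField.Normc.normc0 normc_ge0.
rewrite /modulus ComplexField.Normc.normcM ComplexField.Normc.normcV normc_nat.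
by rewrite ler_piMr ?normc_ge0// invf_le1 ?ltr0n// ler1n.
Qed.

Lemma cesaro_limit_fixed x : cesaro_op t (cesaro_limit x) = cesaro_limit x.
Proof.
apply/funext => n; rewrite /cesaro_op.
rewrite (eq_bigr (fun=> cesaro_limit x n)) => [|i _].
  rewrite sumr_const card_ord -[cesaro_limit x n *+ _]mulr_natr.
  by rewrite mulfK ?pnatr_eq0.
by rewrite /cesaro_limit mulrCA -exprD subnK// -ltnS.
Qed.

Lemma cesaro_resolvent x (y := x - cesaro_limit x) (w := y + weighted_geom y) :
  w - cesaro_op t w = y.
Proof.
have y0 : y 0%N = 0 by rewrite /y !fctE /cesaro_limit expr0 mulr1 subrr.
apply/funext => n; rewrite !fctE cesaro_opE /w geom_resolvent//.
- by rewrite mulrAC divff ?mul1r ?pnatr_eq0// addrK.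
- by move=> k; rewrite mulrC divfK// pnatr_eq0.
- by rewrite y0 mul0r.
Qed.

(** This is the sequence (n t^(n-1)). As a double convolution of a unit vector it lies in [X] by the
    boundedness of the convolution. *)
Definition half_eigenvector : omega := geom t%:C%C (geom t%:C%C (unit_seq R 1)).

Lemma half_eigenvectorE n :
  half_eigenvector n = n%:R * geom t%:C%C (unit_seq R 1) n.
Proof.
rewrite /half_eigenvector; elim: n => [|n IHn]; first by rewrite mul0r.
rewrite [LHS]/= IHn; case: n {IHn} => [|n]; first by rewrite /=; ring.
by rewrite /= /unit_seq /= -[n.+2%:R]natr1; ring.
Qed.

Lemma cesaro_half_eigenvector :
  cesaro_op t half_eigenvector = 2^-1 *: half_eigenvector.
Proof.
apply/funext => n; rewrite cesaro_opE -[RHS]/(2^-1 * half_eigenvector n).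
(* Up to the common power t^(n-1) this is 2 (1 + ... + n) = n (n + 1). *)
suff E : 2 * geom t%:C%C half_eigenvector n = n.+1%:R * half_eigenvector n.
  have n20 : 2 != 0 :> C by rewrite pnatr_eq0.
  apply: (mulfI n20); rewrite mulrA E mulrAC divff ?pnatr_eq0// mul1r.
  by rewrite mulrA divff// mul1r.
elim: n => [|n IHn]; first by rewrite /= half_eigenvectorE !mul0r !mulr0.
rewrite [geom _ _ _]/= mulrDr mulrCA IHn !half_eigenvectorE.
case: n {IHn} => [|n]; first by rewrite /=; ring.
by rewrite /= /unit_seq /= -[n.+3%:R]natr1 -[n.+2%:R]natr1; ring.
Qed.

Lemma half_eigenvector_carrier : half_eigenvector \in lcs_carrier X.
Proof.
have gK x : norm_dominated K x (geom t%:C%C x).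
  by apply: modulus_le_dominated => n; exact: modulus_geom.
do 2 apply: (norm_dominated_carrier cX K0 (gK _)).
exact: unit_seq_carrier.
Qed.

Lemma cesaro_dual_dynamics : exists Ct : clin V V,
  (forall x : V, lcs_val (Ct x) = cesaro_op t (lcs_val x)) /\
  [/\ power_bounded (dual_op Ct), uniformly_mean_ergodic (dual_op Ct) &
      ~ supercyclic (dual_op Ct)].
Proof.
have [T TK TE] := lift_clin cX K0 cesaro_op_linear cesaro_op_dominated.
have [P PK PE] := lift_clin cX K0 cesaro_limit_linear cesaro_limit_dominated.
have [H HK HE] := lift_clin cX K0 weighted_geom_linear weighted_geom_dominated.
have powE m (x : V) :
    lcs_val (clin_pow T m x) = iter m (cesaro_op t) (lcs_val x).
  by elim: m x => //= m IHm x; rewrite TE IHm.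
have powK m : space_bounded K (clin_pow T m).
  move=> x; rewrite powE; apply: modulus_le_dominated => n.
  exact: modulus_iter_cesaro.
have TP (x : V) : T (P x) = P x.
  by apply: lcs_val_inj; rewrite TE PE cesaro_limit_fixed.
have powP m (x : V) : clin_pow T m (P x) = P x.
  by rewrite (@eigen_pow _ _ T 1) ?expr1n ?scale1r.
(* [S x] is the solution w of w - T w = x - P x given by [cesaro_resolvent], as a continuous
   operator. *)
pose S : clin V V := clin_comp (clin_id V + H) (clin_id V - P).
have SE (x : V) : S x = x - P x + H (x - P x).
  by rewrite clin_compE clin_addE clin_subE.
have resolvent (x : V) : S x - T (S x) = x - P x.
  apply: lcs_val_inj; rewrite !lcs_valB TE SE lcs_valD HE lcs_valB PE.
  exact: cesaro_resolvent.
have xE (x : V) : x = P x + (S x - T (S x)) by rewrite resolvent subrKC.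
pose L n := clin_comp (T - clin_pow T n.+1) S.
have K0' := ltW K0.
exists T; split=> //; split.
- apply: power_bounded_dual => U U0.
  have [W W0 WU] := space_bounded_clin_equicontinuous cX K0 U0.
  by exists W => // f [n _ <-]; apply: WU; exact: powK.
- apply: (uniformly_mean_ergodic_dual (P := P) (L := L)) => [U U0|n x n0].
    (* The factors bound, in this order, T - T^(n+1), 1 + H and 1 - P. *)
    have M0 : 0 < (K + K) * ((1 + K) * (1 + K)).
      by rewrite !mulr_gt0 ?addr_gt0.
    have [W W0 WU] := space_bounded_clin_equicontinuous cX M0 U0.
    exists W => // f [n _ <-]; apply: WU.
    apply: space_bounded_comp; first by rewrite addr_ge0.
      by apply: space_boundedD => //; exact: space_boundedN.
    apply: space_bounded_comp; first by rewrite addr_ge0.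
      by apply: space_boundedD => //; exact: space_bounded_id.
    apply: space_boundedD => //; first exact: space_bounded_id.
    exact: space_boundedN.
  (* T^m applied to x = P x + (S x - T S x), with the sign arranged so that the sum over m
     telescopes. *)
  have TS m : clin_pow T m x =
      P x - (clin_pow T m.+1 (S x) - clin_pow T m (S x)).
    by rewrite {1}[x]xE linearD /= powP linearB /= -clin_powSr opprB.
  rewrite ergodic_meanE (eq_bigr _ (fun m _ => TS m)) sumrB telescope_sumr//.
  rewrite sumr_const_nat subn1 /= scalerBr -[P x *+ n](@scaler_nat C).
  rewrite scalerA mulVf ?scale1r.
    by rewrite addrAC subrr add0r -scalerN opprB.
  by rewrite pnatr_eq0 -lt0n.
- pose e0 := LcsVec (unit_seq_carrier 0 cX).
  pose w := LcsVec half_eigenvector_carrier.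
  have [y yE] := coordinate_functional 0 cX.
  have [z zE] := coordinate_functional 1 cX.
  (* [P e0] is (t^n), with coordinates 1 and t at 0 and 1, so z - t y vanishes there; [w] has
     coordinates 0 and 1, so the same functional takes the value 1 at [w]. *)
  apply: (@not_supercyclic_dual _ _ T (P e0) w 2^-1 y (z - t%:C%C *: y)).
  + exact: TP.
  + by apply: lcs_val_inj; rewrite TE cesaro_half_eigenvector.
  + by rewrite normfV normr_nat invf_le1 ?ltr0n// ler1n.
  + by rewrite yE PE /cesaro_limit /unit_seq expr0 mulr1 oner_eq0.
  + rewrite clin_subE clin_scaleE zE yE PE /cesaro_limit /unit_seq /=.
    by rewrite mul1r expr1 mul1r expr0 -[_ *: 1]/(t%:C%C * 1) mulr1 subrr.
  + rewrite clin_subE clin_scaleE zE yE /= !half_eigenvectorE.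
    by rewrite !mul0r scaler0 subr0 /= mulr0 addr0 mul1r oner_eq0.
Qed.

End cesaro.

Theorem proposition6p8 (R : realType) (t : R) (X : seq_lcs R) :
  0 <= t < 1 -> cesaro_space X ->
  exists Ct : clin (lcs_vec X) (lcs_vec X),
    (forall x : lcs_vec X, lcs_val (Ct x) = cesaro_op t (lcs_val x)) /\
    [/\ power_bounded (dual_op Ct),
        uniformly_mean_ergodic (dual_op Ct) &
        ~ supercyclic (dual_op Ct)].
Proof. by move=> /andP[t0 t1]; exact: cesaro_dual_dynamics. Qed.
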